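(* Let $V=\mathbb{C}^d$ with $d>4$ and let $\mathcal{G}$ be one of $GL(V)$, $O(V)$, $Sp(V)$. Suppose that $G$ is a finite subgroup of $\mathcal{G}$ such that $M_4(G,V)=M_4(\mathcal{G},V)$. Then $G$ preserves no tensor structure on $V$ and acts primitively on $V$. In particular, either $G/Z(G)$ is almost simple, or $G$ is contained in the normalizer of an irreducible subgroup of symplectic type of $\mathcal{G}$ (in the latter case, $\dim(V)=p^a$ for some prime $p$).
   Context: $M_{4}(G,V):=\dim\mathrm{End}_G(V^{\otimes2})$. $Sp(V)$ ($d$ even) and $O(V)$ are isometry groups of fixed nondegenerate symplectic, resp. quadratic, forms. ''Preserves a tensor structure'' means that $G$ preserves a decomposition $V=V_1\otimes\cdots\otimes V_m$, $m\ge2$, $\dim V_i\ge2$, possibly permuting the tensor factors. $G$ is primitive on $V$ if it is irreducible and preserves no decomposition $V=\bigoplus_{i=1}^tV_i$ with $t\ge2$ (permuting the nonzero summands). A group $H$ has symplectic type if $H=Z(H)E$ for some extraspecial $p$-subgroup $E$. *)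

(* Defs.v *)
From HB Require Import structures.
From mathcomp Require Import all_boot all_order all_algebra all_fingroup.
From mathcomp Require Import all_solvable mxrepresentation.
From mathcomp Require Import complex mxtens.
From mathcomp Require Import boolp classical_sets reals.

Set Implicit Arguments.
Unset Strict Implicit.
Unset Printing Implicit Defensive.

Import Order.TTheory GRing.Theory Num.Theory.

Local Open Scope classical_set_scope.
Local Open Scope ring_scope.

(* As in mxrepresentation, V = F^d is the space of row vectors 'rV[F]_d, and
   a matrix g acts on V by v |-> v *m g.  A linear group is a set of matrices;
   it may be infinite. *)

Definition is_linear_group (F : fieldType) (d : nat) (H : set 'M[F]_d) : Prop :=
  [/\ H `<=` [set g | g \in unitmx],
      H 1%:M,
      forall g h, H g -> H h -> H (g *m h)
    & forall g, H g -> H (invmx g)].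

Definition repr_image (F : fieldType) (gT : finGroupType) (G : {group gT})
    (d : nat) (rG : mx_representation F G d) : set 'M[F]_d :=
  [set g | exists2 x, x \in G & g = rG x].

Definition GLV (F : fieldType) (d : nat) : set 'M[F]_d :=
  [set g | g \in unitmx].

Definition bform (F : fieldType) (d : nat) (B : 'M[F]_d) (u v : 'rV[F]_d) : F :=
  (u *m B *m v^T) 0 0.

(* Only for 2 != 0 in F: there, each quadratic form is qform B for a unique
   symmetric B, and it is nondegenerate iff B is invertible. *)
Definition qform (F : fieldType) (d : nat) (B : 'M[F]_d) (v : 'rV[F]_d) : F :=
  bform B v v.

Definition OV (F : fieldType) (d : nat) (B : 'M[F]_d) : set 'M[F]_d :=
  [set g | g \in unitmx /\ forall v, qform B (v *m g) = qform B v].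

Definition SpV (F : fieldType) (d : nat) (B : 'M[F]_d) : set 'M[F]_d :=
  [set g | g \in unitmx /\
           forall u v, bform B (u *m g) (v *m g) = bform B u v].

Definition nondeg_quadratic (F : fieldType) (d : nat) (B : 'M[F]_d) : Prop :=
  B^T = B /\ B \in unitmx.

(* Invertibility of an alternating matrix forces d to be even. *)
Definition nondeg_symplectic (F : fieldType) (d : nat) (B : 'M[F]_d) : Prop :=
  (forall v, bform B v v = 0) /\ B \in unitmx.

Definition is_GL_O_or_Sp (F : fieldType) (d : nat) (GG : set 'M[F]_d) : Prop :=
  [\/ GG = @GLV F d,
      exists2 B, nondeg_quadratic B & GG = OV B
    | exists2 B, nondeg_symplectic B & GG = SpV B].

(* The subspace with underlying set P; a junk value if P is not a subspace. *)
Definition vspace_of (F : fieldType) (vT : vectType F) (P : set vT) :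
    {vspace vT} :=
  xget 0%VS [set U : {vspace vT} | forall v, v \in U <-> P v].

Lemma vspace_ofP (F : fieldType) (vT : vectType F) (P : set vT) :
  P 0 -> (forall (a : F) u v, P u -> P v -> P (a *: u + v)) ->
  forall v, v \in vspace_of P <-> P v.
Proof.
move=> P0 Plin.
suff [U UP] : exists U : {vspace vT}, forall v, v \in U <-> P v.
  have exU : exists W, [set W : {vspace vT} | forall v, v \in W <-> P v] W.
    by exists U.
  exact: (xgetPex 0%VS exU).
have main k (U : {vspace vT}) : (\dim {:vT} - \dim U <= k)%N ->
    (forall v, v \in U -> P v) ->
    exists U : {vspace vT}, forall v, v \in U <-> P v.
  elim: k U => [|k IHk] U dimU UP.
    exists U => v; split=> [/UP//|_].
    have /eqP -> : U == fullv by rewrite eqEdim subvf -subn_eq0 -leqn0.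
    exact: memvf.
  have [[v Pv vU]|noV] := pselect (exists2 v, P v & v \notin U); last first.
    exists U => v; split=> [/UP//|Pv].
    by apply: contrapT => /negP vU; case: noV; exists v.
  apply: (IHk (<[v]> + U)%VS); last first.
    move=> w /memv_addP[x /vlineP[a ->] [y /UP Py ->]]; exact: Plin.
  have ltU : (\dim U < \dim (<[v]> + U))%N.
    rewrite ltnNge; apply: contra vU => le_dim.
    have /eqP -> : U == (<[v]> + U)%VS by rewrite eqEdim addvSr.
    by rewrite (subvP (addvSl _ _)) ?memv_line.
  have leU := dimvS (subvf (<[v]> + U)%VS).
  by rewrite leq_subLR (leq_trans _ (leq_add ltU (leqnn k))) // addSnnS -leq_subLR.
apply: (main _ 0%VS (leqnn _)) => v; rewrite memv0 => /eqP ->; exact: P0.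
Qed.

(* End_G(V (x) V), with g acting on V (x) V = 'rV_(d * d) as g (x) g. *)
Definition endT2 (F : fieldType) (d : nat) (G : set 'M[F]_d) :
    set 'M[F]_(d * d) :=
  [set X | forall g, G g -> (g *t g) *m X = X *m (g *t g)].

Definition M4 (F : fieldType) (d : nat) (G : set 'M[F]_d) : nat :=
  \dim (vspace_of (endT2 G)).

Lemma mem_endT2 (F : fieldType) (d : nat) (G : set 'M[F]_d) X :
  X \in vspace_of (endT2 G) <-> endT2 G X.
Proof.
apply: vspace_ofP => [g _|a X1 X2 cX1 cX2 g Gg]; first by rewrite mulmx0 mul0mx.
by rewrite mulmxDr mulmxDl -scalemxAr -scalemxAl cX1 ?cX2.
Qed.

(* The vector v_0 (x) ... (x) v_(m-1) of V, when the isomorphism of V with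
   F^(n 0) (x) ... (x) F^(n (m-1)) sends the basis vector e f of V to the
   tensor product of the standard basis vectors of indices f 0, ..., f (m-1). *)
Definition pure_tensor (F : fieldType) (d m : nat) (n : 'I_m -> nat)
    (e : {dffun forall i : 'I_m, 'I_(n i)} -> 'rV[F]_d)
    (v : forall i : 'I_m, 'rV[F]_(n i)) : 'rV[F]_d :=
  \sum_(f : {dffun forall i : 'I_m, 'I_(n i)}) (\prod_i v i 0 (f i)) *: e f.

Definition preserves_tensor_structure (F : fieldType) (d : nat)
    (G : set 'M[F]_d) : Prop :=
  exists m : nat, exists n : 'I_m -> nat,
  exists e : {dffun forall i : 'I_m, 'I_(n i)} -> 'rV[F]_d,
  [/\ (2 <= m)%N,
      forall i, (2 <= n i)%N,
      basis_of fullv (codom e)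
    & forall g, G g ->
      exists s : 'S_m, exists A : forall i, 'M[F]_(n (s i), n i),
        (forall i, row_free (A i) && row_full (A i)) /\
        forall v : forall i, 'rV[F]_(n i),
          pure_tensor e v *m g = pure_tensor e (fun i => v (s i) *m A i)].

Definition irreducible_on (F : fieldType) (d : nat) (G : set 'M[F]_d) : Prop :=
  (0 < d)%N /\
  forall U : 'M[F]_d, (forall g, G g -> stablemx U g) -> U != 0 -> row_full U.

Lemma irreducible_onE (F : fieldType) (gT : finGroupType) (G : {group gT})
    (d : nat) (rG : mx_representation F G d) :
  irreducible_on (repr_image rG) <-> mx_irreducible rG.
Proof.
have modE U : (forall g, repr_image rG g -> stablemx U g) <-> mxmodule rG U.
  split=> [stU|/mxmoduleP modU _ [x Gx ->]]; last exact: modU.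
  by apply/mxmoduleP => x Gx; apply: stU; exists x.
by rewrite mx_irrP; split=> -[d0 irr]; split=> // U /modE; apply: irr.
Qed.

(* A summand V_i is the row space of the matrix W i. *)
Definition preserves_sum_decomposition (F : fieldType) (d : nat)
    (G : set 'M[F]_d) : Prop :=
  exists t : nat, exists W : 'I_t -> 'M[F]_d,
  [/\ (2 <= t)%N,
      forall i, W i != 0,
      (\sum_i W i :=: 1%:M)%MS,
      mxdirect (\sum_i W i)%MS
    & forall g, G g -> exists s : 'S_t, forall i, (W i *m g :=: W (s i))%MS].

Definition primitive_on (F : fieldType) (d : nat) (G : set 'M[F]_d) : Prop :=
  irreducible_on G /\ ~ preserves_sum_decomposition G.

(* Inn S <= A <= Aut S for a nonabelian simple group S, up to isomorphism. *)
Definition almost_simple (gT : finGroupType) (X : {group gT}) : Prop :=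
  exists sT : finGroupType, exists S : {group sT},
  exists A : {group {perm sT}},
  [/\ simple S, ~~ abelian S, (conj_aut S @* S)%g \subset A, A \subset Aut S
    & (X \isog A)%g].

Definition lin_center (F : fieldType) (d : nat) (H : set 'M[F]_d) :
    set 'M[F]_d :=
  [set z | H z /\ forall h, H h -> z *m h = h *m z].

(* H = Z(H)E, where the extraspecial p-subgroup E of H is the image of a
   faithful representation of an abstract group. *)
Definition symplectic_type (F : fieldType) (d : nat) (p : nat)
    (H : set 'M[F]_d) : Prop :=
  exists eT : finGroupType, exists E : {group eT},
  exists rE : mx_representation F E d,
  [/\ (p.-group E)%g, extraspecial E, mx_faithful rE,
      repr_image rE `<=` H
    & H = [set g | exists z e,
             [/\ lin_center H z, repr_image rE e & g = z *m e]]].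

Definition lin_normalizer (F : fieldType) (d : nat) (GG H : set 'M[F]_d) :
    set 'M[F]_d :=
  [set g | GG g /\ [set invmx g *m h *m g | h in H] = H].

(* Main.v *)
(* Equality of fourth moments means that G and GL(V), O(V) or Sp(V) have the
   same endomorphisms of V (x) V. These are spanned by the identity, the swap
   and, in the last two cases, the contraction by the form: an invariant tensor
   is recovered from its contractions because the sum of the three transpositions
   (1 2), (1 3), (1 4) has norm at most 3 < d - 1.
   A decomposition of V with projections P_i gives the invariant sum of the
   P_i (x) P_i; a tensor structure gives the sum of the partial swaps; a normal
   subgroup N of G gives the sum of the x (x) x^-1 for x in N. None of these is
   in the span unless V is primitive without tensor structure and N is scalar or
   irreducible. Take N over a minimal normal subgroup M of G / Z(G). If M is
   abelian, then N, with scalars added for GL(V), yields the group of symplectic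
   type. Otherwise M is a product of conjugate simple groups S; summing x (x) x^-1
   over the derived subgroups of the preimages of the factors shows that there is
   only one factor, and an irreducible N forces M to have trivial centralizer. *)

Require Import Defs.
From mathcomp Require Import all_boot all_order all_algebra all_fingroup.
From mathcomp Require Import all_solvable mxrepresentation separable cyclotomic.
From mathcomp Require Import complex mxtens.
From mathcomp Require Import boolp classical_sets reals.
From mathcomp Require Import ring zify.

Set Implicit Arguments.
Unset Strict Implicit.
Unset Printing Implicit Defensive.

Import Order.TTheory GRing.Theory Num.Theory.

Local Open Scope classical_set_scope.
Local Open Scope ring_scope.

(** A bare numeric field has no exponential map, so the passage from isometries to skew operators
    goes through Cayley transforms at a few integer parameters. GL(V) contains the isometries of the
    form [1%:M], so one computation serves all three groups. The contraction term is the obstacle to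
    reading off coefficients. It is isolated by rank: on a pure tensor it gives a multiple of the
    invertible matrix [C], while test vectors are chosen so that all other terms together have rank
    below d. The bound d > 4 enters in the norm estimate, in these rank counts, and at the end of
    the study of commuting factors. There two factors in which x + x^-1 is always scalar survive the
    eigenvalue analysis, as in SO(4), and only the equation d^2 = 16 excludes them. Derived
    subgroups are taken because preimages of commuting subgroups of G / Z(G) commute only up to
    scalars. Scalars are added for GL(V) because the p-th powers in N are scalars of unknown order;
    an isometry group contains only the scalars 1 and -1, which forces p = 2. *)

(** * Tensors annihilated by the skew operators of a form *)

Section InvariantTensors.

Variables (F : numFieldType) (d : nat) (e : F) (B C : 'M[F]_d).
Hypotheses (d_gt4 : (4 < d)%N) (e_sign : e = 1 \/ e = -1).
Hypotheses (BT : B^T = e *: B) (BC : B *m C = 1%:M).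

Implicit Types f : 'I_d -> 'I_d -> 'I_d -> 'I_d -> F.

(** Annihilation of [t] by the Lie algebra of the form, which the operators
    [B *m (delta_mx p q - e *: delta_mx q p)] span: the left side is the entry (k, l) of such an
    operator applied to both indices. [form_inv4] is the analogue for four indices. *)
Definition form_inv2 (t : 'I_d -> 'I_d -> F) := forall k l p q,
  B k p * t q l - e * B k q * t p l + B l p * t k q - e * B l q * t k p = 0.

Definition form_inv4 f := forall i j k l p q,
  (B i p * f q j k l - e * B i q * f p j k l) +
  (B j p * f i q k l - e * B j q * f i p k l) +
  (B k p * f i j q l - e * B k q * f i j p l) +
  (B l p * f i j k q - e * B l q * f i j k p) = 0.

(** Contraction by the inverse form, normalised so that [contr B] is d and that contracting against
    one index of [B] only renames an index. *)
Definition contr (h : 'I_d -> 'I_d -> F) : F := \sum_i \sum_p C p i * h i p.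

Lemma e_sqr : e * e = 1.
Proof. by case: e_sign => ->; ring. Qed.

Lemma e_neq0 : e != 0.
Proof. by case: e_sign => ->; rewrite ?oppr_eq0 oner_eq0. Qed.

Lemma formC i j : B i j = e * B j i.
Proof. by have := congr1 (fun M : 'M_d => M j i) BT; rewrite !mxE. Qed.

Lemma CB : C *m B = 1%:M.
Proof. exact: mulmx1C. Qed.

Lemma CT : C^T = e *: C.
Proof.
have B1 : C^T *m (e *: B) = 1%:M by rewrite -BT -trmx_mul BC trmx1.
rewrite -[LHS]mulmx1 -BC mulmxA -[B]scale1r -e_sqr -scalerA -scalemxAr B1.
by rewrite -scalemxAl mul1mx.
Qed.

Lemma cformC i j : C i j = e * C j i.
Proof. by have := congr1 (fun M : 'M_d => M j i) CT; rewrite !mxE. Qed.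

Lemma eq_contr h h' : (forall i p, h i p = h' i p) -> contr h = contr h'.
Proof. by move=> E; apply: eq_bigr => i _; apply: eq_bigr => p _; rewrite E. Qed.

Lemma contrD h h' : contr (fun i p => h i p + h' i p) = contr h + contr h'.
Proof.
rewrite /contr -big_split; apply: eq_bigr => i _.
by rewrite -big_split; apply: eq_bigr => p _; rewrite mulrDr.
Qed.

Lemma contrZ a h : contr (fun i p => a * h i p) = a * contr h.
Proof.
rewrite /contr big_distrr; apply: eq_bigr => i _.
by rewrite big_distrr; apply: eq_bigr => p _ /=; rewrite mulrCA.
Qed.

Lemma contrN h : contr (fun i p => - h i p) = - contr h.
Proof. by rewrite -mulN1r -contrZ; apply: eq_contr => i p; rewrite mulN1r. Qed.

Lemma sum_delta (h : 'I_d -> F) j : \sum_i (i == j)%:R * h i = h j.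
Proof.
rewrite (bigD1 j) //= eqxx mul1r big1 ?addr0 // => i /negPf ->.
by rewrite mul0r.
Qed.

Lemma contr_form_l q (h : 'I_d -> F) :
  contr (fun i p => B i q * h p) = h q.
Proof.
rewrite /contr exchange_big /= -[RHS]sum_delta; apply: eq_bigr => p _.
have := congr1 (fun M : 'M_d => M p q) CB; rewrite !mxE => <-.
by rewrite big_distrl; apply: eq_bigr => i _; rewrite mulrA.
Qed.

Lemma contr_form_r j (h : 'I_d -> F) :
  contr (fun i p => B j p * h i) = h j.
Proof.
rewrite /contr -[RHS]sum_delta; apply: eq_bigr => i _.
have := congr1 (fun M : 'M_d => M j i) BC; rewrite !mxE eq_sym => <-.
by rewrite big_distrl; apply: eq_bigr => p _; rewrite mulrA [C _ _ * _]mulrC.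
Qed.

Lemma contr_form : contr B = d%:R.
Proof.
have -> : contr B = \tr (C *m B).
  rewrite /contr exchange_big; apply: eq_bigr => p _.
  by rewrite !mxE; apply: eq_bigr.
by rewrite CB mxtrace1.
Qed.

Lemma dsize_neq0 (a : F) : `|a| < d%:R -> d%:R - a != 0.
Proof.
move=> ad; rewrite subr_eq0; apply: contraTN ad => /eqP <-.
by rewrite normr_nat ltxx.
Qed.

Lemma norm_e : `|e| = 1.
Proof. by case: e_sign => ->; rewrite ?normrN normr1. Qed.

Lemma dBe_neq0 : d%:R - e != 0.
Proof. by apply: dsize_neq0; rewrite norm_e ltr1n; lia. Qed.

(** Contracting k with p turns invariance into [(d - e) t + t^T = contr t * B]. With its transpose
    this is a 2 by 2 system of determinant [(d - e)^2 - 1], nonzero because d > 2. *)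
Lemma form_inv2E t : form_inv2 t -> exists c, forall i j, t i j = c * B i j.
Proof.
move=> inv.
have E q l : (d%:R - e) * t q l + t l q = contr t * B q l.
  have : contr (fun k p =>
    B k p * t q l - e * B k q * t p l + B l p * t k q - e * B l q * t k p) = 0.
    by rewrite (@eq_contr _ (fun _ _ => 0 * 0)) ?contrZ ?mul0r // => k p;
       rewrite inv mul0r.
  rewrite !contrD !contrN.
  rewrite (@eq_contr (fun k p => B k p * t q l) (fun k p => t q l * B k p));
    last by move=> *; rewrite mulrC.
  rewrite (@eq_contr (fun k p => e * B k q * t p l)
    (fun k p => e * (B k q * t p l))); last by move=> *; rewrite mulrA.
  rewrite !contrZ contr_form contr_form_l contr_form_r => /eqP.
  rewrite subr_eq0 -formC => /eqP; rewrite -[contr _]/(contr t).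
  by rewrite [RHS]mulrC => <-; ring.
exists (contr t * ((d%:R - e) - e) / ((d%:R - e) ^+ 2 - 1)) => i j.
have E1 := E i j; have := E j i; rewrite (formC j i) => E2.
have nz : (d%:R - e) ^+ 2 - 1 != 0.
  have -> : (d%:R - e) ^+ 2 - 1 = (d%:R - (e + 1)) * (d%:R - (e - 1)) by ring.
  by rewrite mulf_neq0 // dsize_neq0 //; case: e_sign => ->;
    rewrite ?subrr ?addNr ?normr0 ?ltr0n -?opprD ?normrN -?(natrD _ 1 1)
     ?normr_nat ?ltr_nat; lia.
apply: (mulIf nz); rewrite mulrAC divfK //.
have -> : t i j * ((d%:R - e) ^+ 2 - 1) =
  (d%:R - e) * ((d%:R - e) * t i j + t j i) - ((d%:R - e) * t j i + t i j).
  by ring.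
by rewrite E1 E2; ring.
Qed.

(** Skew operators kill the form, hence commute with contraction: the terms that act on the two
    contracted indices cancel. *)
Lemma form_inv4_contr f : form_inv4 f ->
  form_inv2 (fun k l => contr (fun i p => f i p k l)).
Proof.
move=> inv k l p q; rewrite -!mulrA -!contrZ.
have : contr (fun i j =>
  (B i p * f q j k l - e * B i q * f p j k l) +
  (B j p * f i q k l - e * B j q * f i p k l) +
  (B k p * f i j q l - e * B k q * f i j p l) +
  (B l p * f i j k q - e * B l q * f i j k p)) = 0.
  by rewrite (@eq_contr _ (fun _ _ => 0 * 0)) ?contrZ ?mul0r // => i j;
     rewrite inv mul0r.
rewrite !contrD !contrN !contrZ contr_form_l.
rewrite (@eq_contr (fun i j => e * B i q * f p j k l)
  (fun i j => e * (B i q * f p j k l))); last by move=> *; rewrite mulrA.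
rewrite (@eq_contr (fun i j => e * B j q * f i p k l)
  (fun i j => B q j * f i p k l)); last by move=> *; rewrite -formC.
rewrite contrZ contr_form_l contr_form_r.
rewrite (@eq_contr (fun i j => B j p * f i q k l)
  (fun i j => e * (B p j * f i q k l))); last by move=> *; rewrite formC mulrA.
rewrite contrZ contr_form_r => E; rewrite -[RHS]E; ring.
Qed.

(** The l1 norm, which every permutation of the four indices preserves. *)
Definition tens_sum f : F := \sum_i \sum_j \sum_k \sum_l `|f i j k l|.

Lemma tens_sum_swap12 f : tens_sum (fun i j k l => f j i k l) = tens_sum f.
Proof. by rewrite /tens_sum exchange_big. Qed.

Lemma tens_sum_swap23 f : tens_sum (fun i j k l => f i k j l) = tens_sum f.
Proof. by rewrite /tens_sum; apply: eq_bigr => i _; rewrite exchange_big. Qed.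

Lemma tens_sum_swap34 f : tens_sum (fun i j k l => f i j l k) = tens_sum f.
Proof.
rewrite /tens_sum; apply: eq_bigr => i _; apply: eq_bigr => j _.
by rewrite exchange_big.
Qed.

Lemma tens_sum_swap13 f : tens_sum (fun i j k l => f k j i l) = tens_sum f.
Proof.
rewrite -[RHS]tens_sum_swap12 -[RHS]tens_sum_swap23.
by rewrite -[RHS]tens_sum_swap12.
Qed.

Lemma tens_sum_swap14 f : tens_sum (fun i j k l => f l j k i) = tens_sum f.
Proof.
by rewrite -[RHS]tens_sum_swap13 -[RHS]tens_sum_swap34 -[RHS]tens_sum_swap13.
Qed.

(* The operator f |-> (1 2) f + (1 3) f + (1 4) f has norm at most 3 < d - e. *)
Lemma jucys_murphy_eq0 f :
    (forall q j k l, (d%:R - e) * f q j k l + f j q k l + f k j q l + f l j k q = 0) ->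
  forall i j k l, f i j k l = 0.
Proof.
move=> E.
have le_e : e <= 1 by case: e_sign => ->; rewrite ?lexx // (le_trans (lerN10 _) ler01).
(* The hypothesis d > 4 is used in full here: d - e is at least d - 1, which exceeds 3 only from d =
   5 on. *)
have le3 : 3%:R < d%:R - e.
  by apply: lt_le_trans (_ : d%:R - 1 <= _);
    rewrite ?lerB // ltrBrDr -(natrD _ 3 1) ltr_nat.
have le_sum : (d%:R - e) * tens_sum f <= 3%:R * tens_sum f.
  have -> : 3%:R * tens_sum f = tens_sum (fun i j k l => f j i k l) +
      tens_sum (fun i j k l => f k j i l) + tens_sum (fun i j k l => f l j k i).
    by rewrite (tens_sum_swap12 f) (tens_sum_swap13 f) (tens_sum_swap14 f); ring.
  rewrite /tens_sum big_distrr -!big_split; apply: ler_sum => i _ /=.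
  rewrite big_distrr -!big_split; apply: ler_sum => j _ /=.
  rewrite big_distrr -!big_split; apply: ler_sum => k _ /=.
  rewrite big_distrr -!big_split; apply: ler_sum => l _ /=.
  have <- : `|d%:R - e| = d%:R - e.
    by rewrite ger0_norm // (le_trans _ (ltW le3)).
  rewrite -normrM.
  have -> : (d%:R - e) * f i j k l = - (f j i k l + f k j i l + f l j k i).
    by rewrite -[RHS]add0r -(E i j k l); ring.
  by rewrite normrN (le_trans (ler_normD _ _)) // lerD2r ler_normD.
have sum_ge0 : 0 <= tens_sum f.
  by do 4!(apply: sumr_ge0 => ? _).
have sum0 : tens_sum f = 0.
  apply/eqP; rewrite eq_le sum_ge0 andbT.
  by rewrite -(pmulr_rle0 _ (_ : 0 < d%:R - e - 3%:R)) ?subr_gt0 // mulrBl subr_le0.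
move=> i j k l; apply/eqP; rewrite -normr_eq0; apply/eqP.
have s1 := psumr_eq0P _ sum0 (i := i) isT.
have s2 := psumr_eq0P _ (s1 _) (i := j) isT.
have s3 := psumr_eq0P _ (s2 _ _) (i := k) isT.
by apply: (psumr_eq0P _ (s3 _ _ _) (i := l) isT) => *; rewrite ?sumr_ge0 // => *;
  rewrite ?sumr_ge0 // => *; rewrite sumr_ge0.
Qed.

(** Contracting i with p expresses [(d - e) f] plus three transposes of [f] through the contractions
    of [f]. A combination of the three pairings with the same contractions satisfies the same
    equation, and the difference vanishes by [jucys_murphy_eq0]. *)
Lemma form_inv4E f : form_inv4 f -> exists x y z, forall i j k l,
  f i j k l = x * (B i j * B k l) + y * (B i k * B j l) + z * (B i l * B j k).
Proof.
move=> inv.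
have [c2 E2] := form_inv2E (form_inv4_contr inv).
have inv3 : form_inv4 (fun i j k l => f i k j l).
  by move=> i j k l p q; rewrite -[RHS](inv i k j l p q); ring.
have [c3 E3] := form_inv2E (form_inv4_contr inv3).
have inv4 : form_inv4 (fun i j k l => f i k l j).
  by move=> i j k l p q; rewrite -[RHS](inv i k l j p q); ring.
have [c4 E4] := form_inv2E (form_inv4_contr inv4).
have E q j k l :
    (d%:R - e) * f q j k l + f j q k l + f k j q l + f l j k q =
    e * (c2 * (B j q * B k l) + c3 * (B k q * B j l) + c4 * (B l q * B j k)).
  have : contr (fun i p =>
    (B i p * f q j k l - e * B i q * f p j k l) +
    (B j p * f i q k l - e * B j q * f i p k l) +
    (B k p * f i j q l - e * B k q * f i j p l) +
    (B l p * f i j k q - e * B l q * f i j k p)) = 0.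
    by rewrite (@eq_contr _ (fun _ _ => 0 * 0)) ?contrZ ?mul0r // => i p;
       rewrite inv mul0r.
  rewrite !contrD !contrN !contrZ E2 E3 E4 !contr_form_r.
  rewrite (@eq_contr (fun i p => B i p * f q j k l)
    (fun i p => f q j k l * B i p)); last by move=> *; rewrite mulrC.
  rewrite (@eq_contr (fun i p => e * B i q * f p j k l)
    (fun i p => e * (B i q * f p j k l))); last by move=> *; rewrite mulrA.
  rewrite !contrZ contr_form contr_form_l => E.
  by apply/eqP; rewrite -subr_eq0; apply/eqP; rewrite -[RHS]E; ring.
have nz := dBe_neq0.
have nz2 : d%:R + 2%:R * e != 0.
  rewrite -[X in _ + X]opprK dsize_neq0 // normrN normrM norm_e mulr1 normr_nat.
  by rewrite ltr_nat; lia.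
(* [x], [y], [z] solve the system [xE], [yE], [zE] that prescribes the three contractions. Adding
   these equations with weights 1, e, 1 gives [(d + 2 e) (x + e y + z)], so [s] is the value of
   [x + e y + z]. *)
pose s := (c2 + e * c3 + c4) / (d%:R + 2%:R * e).
pose x := (c2 - e * s) / (d%:R - e).
pose y := (c3 - s) / (d%:R - e).
pose z := (c4 - e * s) / (d%:R - e).
have sE : x + e * y + z = s by rewrite /x /y /z /s; field; rewrite nz nz2.
have xE : d%:R * x + y + e * z = c2.
  have -> : c2 = (d%:R - e) * x + e * s by rewrite /x; field.
  by rewrite -sE; transitivity (d%:R * x + e * e * y + e * z); [rewrite e_sqr|]; ring.
have yE : x + d%:R * y + z = c3.
  have -> : c3 = (d%:R - e) * y + s by rewrite /y; field.
  by rewrite -sE; ring.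
have zE : e * x + y + d%:R * z = c4.
  have -> : c4 = (d%:R - e) * z + e * s by rewrite /z; field.
  by rewrite -sE; transitivity (d%:R * z + e * e * y + e * x); [rewrite e_sqr|]; ring.
exists x, y, z => i j k l; apply/eqP; rewrite -subr_eq0; apply/eqP.
pose u i j k l := f i j k l -
  (x * (B i j * B k l) + y * (B i k * B j l) + z * (B i l * B j k)).
rewrite -[LHS]/(u i j k l); move: i j k l; apply: jucys_murphy_eq0 => q j k l.
rewrite /u.
have /eqP := E q j k l; rewrite -subr_eq0 => /eqP <-; rewrite -xE -yE -zE.
rewrite (formC j q) (formC k j) (formC k q) (formC l q) (formC l j) (formC l k).
by move: {+}x {+}y {+}z; case: e_sign => -> *; ring.
Qed.

End InvariantTensors.

(** * Matrix units and derivations on V (x) V *)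

Section TensorOperators.

Variables (F : fieldType) (d : nat).

Lemma tensmxDl m n p q (A A' : 'M[F]_(m, n)) (B : 'M_(p, q)) :
  (A + A') *t B = A *t B + A' *t B.
Proof. by apply/matrixP=> i j; rewrite !mxE mulrDl. Qed.

Lemma tensmxDr m n p q (A : 'M[F]_(m, n)) (B B' : 'M_(p, q)) :
  A *t (B + B') = A *t B + A *t B'.
Proof. by apply/matrixP=> i j; rewrite !mxE mulrDr. Qed.

Lemma tensmx11 : (1%:M : 'M[F]_d) *t (1%:M : 'M[F]_d) = 1%:M.
Proof.
apply/matrixP => s t; case: (mxtens_indexP s) => i j.
case: (mxtens_indexP t) => k l; rewrite tensmxE !mxE.
rewrite (can_eq (@mxtens_indexK d d)) xpair_eqE.
by case: (i == k); case: (j == l); rewrite ?mulr1n ?mulr0n ?mulr1 ?mulr0.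
Qed.

Lemma sum_mxtens (h : 'I_(d * d) -> F) :
  \sum_s h s = \sum_i \sum_j h (mxtens_index (i, j)).
Proof.
rewrite pair_big (reindex (fun p : 'I_d * 'I_d => mxtens_index p)) /=.
  by apply: eq_bigr => -[].
by exists (@mxtens_unindex d d) => ? _; rewrite (mxtens_indexK, mxtens_unindexK).
Qed.

Lemma mulmx_delta (A : 'M[F]_d) p q r s :
  delta_mx p q *m A *m delta_mx r s = A q r *: (delta_mx p s : 'M_d).
Proof.
rewrite -(mul_delta_mx (0 : 'I_1) p q) -(mul_delta_mx (0 : 'I_1) r s) !mulmxA.
rewrite -[_ *m A]mulmxA -rowE -[_ *m row q A *m _]mulmxA -colE.
rewrite [col r _]mx11_scalar !mxE mul_mx_scalar -scalemxAl.
by rewrite mul_delta_mx.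
Qed.

(** The derivative of g |-> [g *t g] at the identity in the direction [N]. *)
Definition leib (N : 'M[F]_d) : 'M[F]_(d * d) := N *t 1%:M + 1%:M *t N.

Lemma leibD N N' : leib (N + N') = leib N + leib N'.
Proof. by rewrite /leib tensmxDl tensmxDr addrACA. Qed.

Lemma mul_leib_l N (W : 'M[F]_(d * d)) i j s :
  (leib N *m W) (mxtens_index (i, j)) s =
  \sum_a N i a * W (mxtens_index (a, j)) s +
  \sum_a N j a * W (mxtens_index (i, a)) s.
Proof.
rewrite mulmxDl mxE; congr (_ + _); rewrite mxE sum_mxtens.
  apply: eq_bigr => a _; rewrite (bigD1 j) //= big1 ?addr0 => [|b nb].
    by rewrite tensmxE mxE eqxx mulr1.
  by rewrite tensmxE !mxE eq_sym (negPf nb) mulr0 mul0r.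
rewrite (bigD1 i) //= [X in _ + X]big1 ?addr0 => [|b nb].
  by apply: eq_bigr => a _; rewrite tensmxE mxE eqxx mul1r.
by apply: big1 => a _; rewrite tensmxE !mxE eq_sym (negPf nb) !mul0r.
Qed.

Lemma mul_leib_r N (W : 'M[F]_(d * d)) i j s :
  (W *m (leib N)^T) s (mxtens_index (i, j)) =
  \sum_a N i a * W s (mxtens_index (a, j)) +
  \sum_a N j a * W s (mxtens_index (i, a)).
Proof.
have := mul_leib_l N W^T i j s.
have -> : leib N *m W^T = (W *m (leib N)^T)^T by rewrite trmx_mul trmxK.
rewrite mxE => ->; congr (_ + _); apply: eq_bigr => a _; first by rewrite mxE.
by rewrite mxE.
Qed.

End TensorOperators.

(** * Operators on V (x) V that commute with all isometries *)

Section FormOperators.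

Variables (F : numFieldType) (d : nat) (e : F) (B C : 'M[F]_d).
Hypotheses (d_gt4 : (4 < d)%N) (e_sign : e = 1 \/ e = -1).
Hypotheses (BT : B^T = e *: B) (BC : B *m C = 1%:M).

Variable X : 'M[F]_(d * d).
Hypothesis comX : forall g, g *m B *m g^T = B -> (g *t g) *m X = X *m (g *t g).

Definition commX (Y : 'M[F]_(d * d)) := Y *m X - X *m Y.

Lemma commXD Y Y' : commX (Y + Y') = commX Y + commX Y'.
Proof. by rewrite /commX mulmxDl mulmxDr opprD addrACA. Qed.

Lemma commXZ a Y : commX (a *: Y) = a *: commX Y.
Proof. by rewrite /commX -scalemxAl -scalemxAr scalerBr. Qed.

(** [N = B *m S] is skew for the form, so the Cayley transforms of its multiples are isometries, and
    [N^3 = - D N] makes them quadratic in [N]. The part of [g m *t g m] that is odd in m contains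
    [leib N]; two values of m eliminate the other summand, built from [N] and [N^2]. *)
Lemma comm_skew_rank2 S D : S^T = (- e) *: S ->
  B *m S *m (B *m S) *m (B *m S) = (- D) *: (B *m S) -> commX (leib (B *m S)) = 0.
Proof.
move=> ST; set N := B *m S => N3.
pose q m : F := D + m%:R ^+ 2.
have BNT : B *m N^T = - N *m B.
  rewrite trmx_mul ST BT -scalemxAl -!scalemxAr scalerA mulNr.
  by rewrite (e_sqr e_sign) scaleN1r mulmxA mulNmx.
pose N2 := N *m N.
have BN2T : B *m N2^T = N2 *m B.
  by rewrite trmx_mul mulmxA BNT -mulmxA BNT mulmxA mulNmx mulmxN opprK.
have NN2 : N *m N2 = (- D) *: N by rewrite mulmxA.
have N2N : N2 *m N = (- D) *: N by [].
have N2N2 : N2 *m N2 = (- D) *: N2.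
  by rewrite {1}/N2 -mulmxA NN2 -scalemxAr.
(* This is (m + N)(m - N)^-1, expanded by means of [N^3 = - D N]. *)
pose g m := 1%:M + (2%:R * m / (D + m ^+ 2)) *: N + (2%:R / (D + m ^+ 2)) *: N2.
have gP m : D + m ^+ 2 != 0 -> g m *m B *m (g m)^T = B.
  move=> nz; rewrite -mulmxA /g; set be := 2%:R / _; set al := _ / _.
  have -> : (1%:M + al *: N + be *: N2)^T = 1%:M + al *: N^T + be *: N2^T.
    by apply/matrixP => i j; rewrite !mxE eq_sym.
  have -> : B *m (1%:M + al *: N^T + be *: N2^T) =
      (1%:M - al *: N + be *: N2) *m B.
    rewrite !mulmxDl !mulmxDr mul1mx mulmx1 -!scalemxAr BNT BN2T !mulNmx scalerN.
    by rewrite -!scalemxAl.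
  rewrite mulmxA; have -> : (1%:M + al *: N + be *: N2) *m
    (1%:M - al *: N + be *: N2) = 1%:M; last by rewrite mul1mx.
  rewrite !mulmxDl !mulmxDr !mul1mx !mulmx1 !mulmxN -!scalemxAl -!scalemxAr.
  rewrite NN2 N2N N2N2 -[N *m N]/N2; apply/matrixP => i j.
  by rewrite !mxE /al /be; field.
have sgE (Y Z : 'M[F]_d) a : ((Y + a *: Z) *t (Y + a *: Z)) -
    ((Y - a *: Z) *t (Y - a *: Z)) = 2%:R * a *: (Z *t Y + Y *t Z).
  by apply/matrixP => i j; rewrite !mxE; ring.
have step m : m != 0 -> D + m ^+ 2 != 0 ->
    commX (leib N) + (2%:R / (D + m ^+ 2)) *: commX (N *t N2 + N2 *t N) = 0.
  move=> m0 nz; set be := _ / _.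
  have c1 : commX (g m *t g m) = 0.
    by apply/eqP; rewrite subr_eq0 comX // gP.
  have c2 : commX (g (- m) *t g (- m)) = 0.
    by apply/eqP; rewrite subr_eq0 comX // gP // sqrrN.
  have := sgE (1%:M + be *: N2) N (be * m).
  have -> : 1%:M + be *: N2 + (be * m) *: N = g m.
    by rewrite /g addrAC /be mulrAC.
  have -> : 1%:M + be *: N2 - (be * m) *: N = g (- m).
    by rewrite /g addrAC /be sqrrN mulrN mulNr scaleNr mulrAC.
  move/(congr1 commX); rewrite -scaleN1r commXD commXZ commXZ c1 c2 scaler0 addr0.
  move/esym/eqP; rewrite scaler_eq0 => /orP[|/eqP <-].
    by rewrite !mulf_eq0 invr_eq0 pnatr_eq0 (negPf nz) (negPf m0).
  rewrite -commXZ -commXD; congr commX; rewrite /leib.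
  by apply/matrixP => i j; rewrite !mxE; ring.
have two m n : m != 0 -> n != 0 -> m ^+ 2 != n ^+ 2 -> D + m ^+ 2 != 0 ->
    D + n ^+ 2 != 0 -> commX (leib N) = 0.
  move=> m0 n0 mn mz nz; have s1 := step m m0 mz; have s2 := step n n0 nz.
  have : ((2%:R / (D + m ^+ 2)) - (2%:R / (D + n ^+ 2))) *:
      commX (N *t N2 + N2 *t N) = 0.
    by rewrite scalerBl -[RHS](subrr 0) -{1}s1 -{1}s2 opprD addrACA subrr add0r.
  move/eqP; rewrite scaler_eq0 => /orP[|/eqP E].
    rewrite -mulrBr mulf_eq0 pnatr_eq0 /= subr_eq0 => /eqP /invr_inj /addrI E.
    by rewrite E eqxx in mn.
  by move: s1; rewrite E scaler0 addr0.
have nz1 : (1 : F) != 0 by rewrite oner_eq0.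
have nz2 : (2%:R : F) != 0 by rewrite pnatr_eq0.
have nz3 : (3%:R : F) != 0 by rewrite pnatr_eq0.
have nat_nz k : (k.+1%:R : F) != 0 by rewrite pnatr_eq0.
have sq12 : (1 : F) ^+ 2 != 2%:R ^+ 2.
  by rewrite eq_sym -subr_eq0 (_ : _ - _ = 3%:R); [exact: nat_nz|ring].
have sq13 : (1 : F) ^+ 2 != 3%:R ^+ 2.
  by rewrite eq_sym -subr_eq0 (_ : _ - _ = 8%:R); [exact: nat_nz|ring].
have sq23 : (2%:R : F) ^+ 2 != 3%:R ^+ 2.
  by rewrite eq_sym -subr_eq0 (_ : _ - _ = 5%:R); [exact: nat_nz|ring].
have distinctP a b : a != b -> D + a = 0 -> D + b != 0.
  by move=> ab Da; apply: contra ab => /eqP Db; apply/eqP/(@addrI _ D); rewrite Da.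
(* The squares of 1, 2, 3 are distinct, so at most one of these values makes [D + m ^+ 2] vanish and
   two usable ones remain. *)
have [D1|D1] := eqVneq (D + 1 ^+ 2) 0.
  by apply: (two 2%:R 3%:R) => //; apply: distinctP D1.
have [D2|D2] := eqVneq (D + 2%:R ^+ 2) 0; last exact: (two 1 2%:R).
by apply: (two 1 3%:R) => //; apply: distinctP D2.
Qed.

Lemma form_alternate : e = -1 -> forall u : 'rV[F]_d, u *m B *m u^T = 0.
Proof.
move=> eE u; have BTN : B^T = - B by rewrite BT eE scaleN1r.
have M : (u *m B *m u^T)^T = - (u *m B *m u^T).
  by rewrite !trmx_mul trmxK BTN mulNmx mulmxN mulmxA.
apply/matrixP => i j; rewrite (ord1 i) (ord1 j) [RHS]mxE.
have := congr1 (fun A : 'M_1 => A 0 0) M; rewrite mxE [RHS]mxE => /eqP.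
by rewrite -addr_eq0 -mulr2n mulrn_eq0 /= => /eqP.
Qed.

Definition elem p q : 'M[F]_d := delta_mx p q - e *: delta_mx q p.

(** For e = 1 the operator has rank at most two and D is the Gram determinant of the basis vectors p
    and q. For e = -1 it is polarised into operators [B *m (u^T *m u)], which square to zero because
    the form is alternating; they satisfy the cubic relation with D = 0. *)
Lemma comm_elem p q : commX (leib (B *m elem p q)) = 0.
Proof.
case: e_sign => eE; rewrite /elem eE ?scale1r ?scaleN1r ?opprK.
  apply: (@comm_skew_rank2 _ (B p p * B q q - B p q ^+ 2)).
    by rewrite eE scaleN1r linearB /= !trmx_delta opprB.
  have Bqp : B q p = B p q by rewrite (formC BT) eE mul1r.
  set S := delta_mx p q - _.
  have SBS : S *m B *m S = B p q *: delta_mx p q + B p q *: delta_mx q p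
      - B q q *: delta_mx p p - B p p *: delta_mx q q.
    rewrite /S !(mulmxBl, mulmxBr) !mulmx_delta Bqp.
    by move: (delta_mx p q) (delta_mx q p) (delta_mx p p) (delta_mx q q) => *;
      apply/matrixP => i j; rewrite !mxE; ring.
  have SBSBS : S *m B *m S *m B *m S = - (B p p * B q q - B p q ^+ 2) *: S.
    rewrite SBS /S !(mulmxBl, mulmxBr, mulmxDl, mulNmx) -!scalemxAl !mulmx_delta Bqp.
    by move: (delta_mx p q) (delta_mx q p) (delta_mx p p) (delta_mx q q) => *;
      apply/matrixP => i j; rewrite !mxE; ring.
  by rewrite scalemxAr -SBSBS !mulmxA.
have sq (u : 'rV[F]_d) : commX (leib (B *m (u^T *m u))) = 0.
  apply: (@comm_skew_rank2 _ 0).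
    by rewrite eE opprK scale1r trmx_mul trmxK.
  have -> : B *m (u^T *m u) *m (B *m (u^T *m u)) = 0.
    rewrite -!mulmxA [u *m (B *m _)]mulmxA [u *m B *m _]mulmxA form_alternate //.
    by rewrite mul0mx !mulmx0.
  by rewrite mul0mx oppr0 scale0r.
have del (r s : 'I_d) : delta_mx r s =
    (delta_mx 0 r : 'rV[F]_d)^T *m (delta_mx 0 s : 'rV[F]_d) :> 'M[F]_d.
  by rewrite trmx_delta mul_delta_mx.
have := sq (delta_mx 0 p + delta_mx 0 q).
set u : 'rV[F]_d := delta_mx 0 p; set v : 'rV[F]_d := delta_mx 0 q.
have -> : (u + v)^T *m (u + v) = delta_mx p p + (delta_mx p q + delta_mx q p) + delta_mx q q :> 'M[F]_d.
  rewrite !del -/u -/v; have -> : (u + v)^T = u^T + v^T.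
    by apply/matrixP => i j; rewrite !mxE.
  by rewrite mulmxDl !mulmxDr !addrA.
by rewrite 2!mulmxDr 2!leibD 2!commXD (del p p) sq add0r (del q q) sq addr0.
Qed.

Let W i j k l :=
  (X *m (B *t B)) (mxtens_index (i, j)) (mxtens_index (k, l)).

(** Multiplication by [B *t B] lowers the column indices of [X]. As [N] is skew for the form,
    commuting with [leib N] then becomes annihilation by [N] on all four indices. *)
Lemma form_inv4_op : form_inv4 e B W.
Proof.
move=> i j k l p q; set N := B *m elem p q.
have BNT : B *m N^T = - (N *m B).
  have ET : (elem p q)^T = - e *: elem p q.
    rewrite /elem linearB linearZ /= !trmx_delta scalerBr scalerA.
    by rewrite !mulNr (e_sqr e_sign) !scaleNr scale1r opprK addrC.
  rewrite /N trmx_mul ET BT -scalemxAl -!scalemxAr scalerA.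
  by rewrite mulNr (e_sqr e_sign) scaleN1r mulmxA.
have skew : leib N *m (X *m (B *t B)) + (X *m (B *t B)) *m (leib N)^T = 0.
  have -> : (leib N)^T = N^T *t 1%:M + 1%:M *t N^T.
    by rewrite /leib linearD /= !trmx_tens trmx1.
  have /eqP := comm_elem p q; rewrite subr_eq0 => /eqP E.
  rewrite mulmxA E -!mulmxA -mulmxDr.
  have -> : leib N *m (B *t B) + B *t B *m (N^T *t 1%:M + 1%:M *t N^T) = 0.
    rewrite /leib mulmxDl mulmxDr !tensmx_mul !mulmx1 !mul1mx BNT.
    by apply/matrixP => s t; rewrite !mxE; ring.
  by rewrite mulmx0.
have := congr1 (fun M : 'M_(d * d) => M (mxtens_index (i, j)) (mxtens_index (k, l))) skew.
rewrite mxE mul_leib_l mul_leib_r mxE => <-.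
have NE a b : N a b = B a p * (b == q)%:R - e * B a q * (b == p)%:R.
  rewrite /N /elem mulmxBr -scalemxAr !mxE; congr (_ - _).
    by rewrite (bigD1 p) //= big1 ?addr0 ?mxE ?eqxx // => c /negPf cp;
       rewrite mxE cp mulr0.
  rewrite (bigD1 q) //= big1 ?addr0 ?mxE ?eqxx ?mulrA // => c /negPf cp.
  by rewrite mxE cp mulr0.
have sumN a (h : 'I_d -> F) :
    \sum_b N a b * h b = B a p * h q - e * B a q * h p.
  rewrite -(sum_delta h q) -(sum_delta h p) !big_distrr /= -sumrB.
  by apply: eq_bigr => b _; rewrite NE; ring.
by rewrite !sumN /W !addrA.
Qed.

Lemma form_op_entries : exists a b c : F, forall i j k l,
  X (mxtens_index (i, j)) (mxtens_index (k, l)) =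
  a * ((i == k)%:R * (j == l)%:R) + b * ((i == l)%:R * (j == k)%:R)
  + c * (B i j * C k l).
Proof.
have [x [y [z E]]] := form_inv4E d_gt4 e_sign BT BC form_inv4_op.
(* Multiplying back by [C *t C] turns the pairings with coefficients x, y, z into contraction,
   identity and swap. The factor e comes from [C l k = e * C k l]. *)
exists y, z, (x * e) => i j k l.
have sumB a b : \sum_c B a c * C c b = (a == b)%:R.
  by have := congr1 (fun M : 'M_d => M a b) BC; rewrite !mxE.
have -> : X = X *m (B *t B) *m (C *t C).
  by rewrite -mulmxA tensmx_mul BC tensmx11 mulmx1.
rewrite mxE sum_mxtens.
transitivity (\sum_a \sum_b (x * B i j * ((B a b * C b l) * C a k)
   + y * ((B i a * C a k) * (B j b * C b l))
   + z * ((B j a * C a k) * (B i b * C b l)))).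
  apply: eq_bigr => a _; apply: eq_bigr => b _.
  by rewrite -[X in X * _]/(W i j a b) E tensmxE; ring.
have S1 u : \sum_a \sum_b u * ((B a b * C b l) * C a k) = u * C l k.
  transitivity (\sum_a (a == l)%:R * (u * C a k)); last by rewrite (sum_delta (fun a => u * C a k)).
  by apply: eq_bigr => a _; rewrite -mulr_sumr -mulr_suml sumB; ring.
have S2 u (p q : 'I_d -> F) : \sum_a \sum_b u * (p a * q b) =
    u * ((\sum_a p a) * (\sum_b q b)).
  rewrite mulr_suml mulr_sumr; apply: eq_bigr => a _.
  by rewrite -mulr_sumr -mulr_sumr.
under eq_bigr do rewrite !big_split.
rewrite !big_split /= S1 !S2 !sumB (cformC e_sign BT BC l).
by rewrite /=; ring.
Qed.

End FormOperators.

(** * From equal fourth moments to standard operators *)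

Section StandardOperators.

Variables (F : numFieldType) (d : nat).
Implicit Types (G GG : set 'M[F]_d) (B C : 'M[F]_d).

Definition form_pair (e : F) B C :=
  [/\ e = 1 \/ e = -1, B^T = e *: B & B *m C = 1%:M].

(* The combination a * id + b * (swap of the factors) + c * (contraction with
   B followed by multiplication by the invariant tensor C). *)
Definition std_op B C (a b c : F) (X : 'M[F]_(d * d)) := forall i j k l,
  X (mxtens_index (i, j)) (mxtens_index (k, l)) =
  a * ((i == k)%:R * (j == l)%:R) + b * ((i == l)%:R * (j == k)%:R)
  + c * (B i j * C k l).

(* The disjunction separates the linear group, for which no contraction occurs,
   from the groups that preserve the form B. *)
Definition std_endT2 G B C := forall X, endT2 G X ->
  exists a b c, std_op B C a b c X /\
    (c = 0 \/ forall g, G g -> g *m B *m g^T = B).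

(** Inclusion of groups reverses the inclusion of commutants, so equal dimensions force equality. *)
Lemma endT2_M4 G GG X : G `<=` GG -> M4 G = M4 GG -> endT2 G X -> endT2 GG X.
Proof.
move=> sub eqM4 /mem_endT2 XG; apply/mem_endT2.
suff -> : vspace_of (endT2 GG) = vspace_of (endT2 G) by [].
apply/eqP; rewrite eqEdim; apply/andP; split; last by rewrite -/(M4 _) eqM4.
apply/subvP => Y /mem_endT2 YGG; apply/mem_endT2 => g /sub; exact: YGG.
Qed.

Lemma bformE B (u v : 'rV_d) g : bform B (u *m g) (v *m g) = bform (g *m B *m g^T) u v.
Proof. by rewrite /bform trmx_mul !mulmxA. Qed.

Lemma bform_delta B i j : bform B (delta_mx 0 i) (delta_mx 0 j) = B i j.
Proof. by rewrite /bform trmx_delta -rowE -colE !mxE. Qed.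

Lemma bform_addl B (u u' v : 'rV_d) : bform B (u + u') v = bform B u v + bform B u' v.
Proof. by rewrite /bform !mulmxDl mxE. Qed.

Lemma bform_addr B (u v v' : 'rV_d) : bform B u (v + v') = bform B u v + bform B u v'.
Proof.
rewrite /bform; have -> : (v + v')^T = v^T + v'^T.
  by apply/matrixP => i j; rewrite !mxE.
by rewrite mulmxDr mxE.
Qed.

Lemma bform_sym B (u v : 'rV_d) : B^T = B -> bform B u v = bform B v u.
Proof.
move=> BT; rewrite /bform; transitivity ((u *m B *m v^T)^T 0 0).
  by rewrite [RHS]mxE.
by rewrite !trmx_mul trmxK BT mulmxA.
Qed.

Lemma isometry_OV B g : B \in unitmx -> g *m B *m g^T = B -> OV B g.
Proof.
move=> Bu gB; split=> [|v]; last by rewrite /qform bformE gB.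
have : g *m (B *m g^T *m invmx B) = 1%:M by rewrite !mulmxA gB mulmxV.
by case/mulmx1_unit.
Qed.

Lemma OV_isometry B g : B^T = B -> OV B g -> g *m B *m g^T = B.
Proof.
move=> BT [_ qg]; set B' := g *m B *m g^T.
have B'T : B'^T = B' by rewrite /B' !trmx_mul trmxK BT mulmxA.
have q v : bform B' v v = bform B v v by have := qg v; rewrite /qform bformE.
apply/matrixP => i j; rewrite -!bform_delta.
set u := delta_mx 0 i; set v := delta_mx 0 j.
have := q (u + v); rewrite !(bform_addl, bform_addr) !q.
rewrite (bform_sym v u B'T) (bform_sym v u BT).
rewrite -!addrA => /addrI; rewrite !addrA => /addIr /eqP.
rewrite -!mulr2n -subr_eq0 -mulrnBl mulrn_eq0 /= subr_eq0 => /eqP //.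
Qed.

Lemma SpV_isometryE B g : B \in unitmx -> SpV B g <-> g *m B *m g^T = B.
Proof.
move=> Bu; split=> [[_ gB]|gB].
  by apply/matrixP => i j; rewrite -!bform_delta -gB bformE.
by case: (isometry_OV Bu gB) => gu _; split=> // u v; rewrite bformE gB.
Qed.

Lemma symplectic_tr B : nondeg_symplectic B -> B^T = -1 *: B.
Proof.
case=> alt _; apply/matrixP => i j; rewrite !mxE mulN1r -!bform_delta.
apply/eqP; rewrite -addr_eq0; apply/eqP.
set u := delta_mx 0 i; set v := delta_mx 0 j.
by have := alt (u + v); rewrite !(bform_addl, bform_addr) !alt add0r addr0 addrC.
Qed.

(** GL(V) contains the isometries of the identity form, which leaves three parameters; the matrix
    diag(2, 1, ..., 1) then excludes the contraction. *)
Lemma GL_std_op X : (4 < d)%N -> endT2 (@GLV F d) X ->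
  exists a b, std_op 1%:M 1%:M a b 0 X.
Proof.
move=> d4 XGL.
have [||||a [b [c E]]] := @form_op_entries F d 1 1%:M 1%:M d4 _ _ _ X.
- by left.
- by rewrite trmx1 scale1r.
- by rewrite mulmx1.
- by move=> g; rewrite mulmx1 => /mulmx1_unit[gu _]; apply: XGL.
suff c0 : c = 0 by exists a, b; rewrite -c0.
pose i0 : 'I_d := Ordinal (ltn_trans (isT : 0 < 4)%N d4).
pose i1 : 'I_d := Ordinal (ltn_trans (isT : 1 < 4)%N d4).
pose D : 'M[F]_d := diag_mx (\row_i (1 + (i == i0)%:R)).
have Du : D \in unitmx.
  rewrite unitmxE det_diag unitfE; apply/prodf_neq0 => i _; rewrite mxE.
  by case: (i == i0); rewrite ?addr0 ?oner_eq0 // -(natrD _ 1 1) pnatr_eq0.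
(* At the entry with row (0, 0) and column (1, 1) the two products are 4 c and c. *)
have := congr1 (fun M : 'M_(d * d) =>
  M (mxtens_index (i0, i0)) (mxtens_index (i1, i1))) (XGL D Du).
have DE i j : D i j = (1 + (i == i0)%:R) *+ (i == j) by rewrite !mxE.
rewrite !mxE !sum_mxtens.
have X01 : X (mxtens_index (i0, i0)) (mxtens_index (i1, i1)) = c.
  by rewrite E !mxE !eqxx (_ : (i0 == i1) = false) //=; ring.
rewrite (bigD1 i0) //= (bigD1 i0) //= [X in _ + X + _]big1 ?addr0; last first.
  by move=> i ni; rewrite tensmxE !DE eq_sym (negPf ni) mulr0n mulr0 mul0r.
rewrite big1 ?addr0; last first.
  move=> i ni; apply: big1 => j _.
  by rewrite tensmxE !DE eq_sym (negPf ni) mulr0n !mul0r.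
rewrite (bigD1 i1) //= (bigD1 i1) //= [X in _ = _ + X + _]big1 ?addr0; last first.
  by move=> i ni; rewrite tensmxE !DE (negPf ni) mulr0n !mulr0.
rewrite big1 ?addr0; last first.
  move=> i ni; apply: big1 => j _.
  by rewrite tensmxE !DE (negPf ni) mulr0n mul0r mulr0.
rewrite X01 !tensmxE !DE /= !mulr1n => /eqP; rewrite -subr_eq0.
have -> : (1 + 1%:R) * (1 + 1%:R) * c - c * ((1 + 0%:R) * (1 + 0%:R)) = 3%:R * c.
  by ring.
by rewrite mulf_eq0 pnatr_eq0 => /eqP.
Qed.

(** For GL(V) the form is the placeholder [1%:M], which G need not preserve. The last clause
    separates this case from the one where G preserves [B] and [GG] contains every isometry of
    [B]. *)
Lemma M4_std_endT2 G GG : (4 < d)%N -> is_GL_O_or_Sp GG -> G `<=` GG ->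
  M4 G = M4 GG -> exists e B C,
  [/\ form_pair e B C, std_endT2 G B C
   & GG = @GLV F d \/
     ((forall g, G g -> g *m B *m g^T = B) /\
      forall g, g *m B *m g^T = B -> GG g)].
Proof.
move=> d4 GGP sub eqM4.
have trans X : endT2 G X -> endT2 GG X by exact: endT2_M4.
case: GGP => [GGE|[B [BT Bu] GGE]|[B sB GGE]].
- exists 1, 1%:M, 1%:M; split; last by left.
    by split; [left|rewrite trmx1 scale1r|rewrite mulmx1].
  move=> X /trans; rewrite GGE => /(GL_std_op d4)[a [b E]].
  by exists a, b, 0; split=> //; left.
- have isoG g : G g -> g *m B *m g^T = B.
    by move/sub; rewrite GGE; apply: OV_isometry.
  exists 1, B, (invmx B); split.
  + by split; [left|rewrite scale1r|rewrite mulmxV].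
  + move=> X /trans; rewrite GGE => XO.
    have [||||a [b [c E]]] := @form_op_entries F d 1 B (invmx B) d4 _ _ _ X.
    * by left.
    * by rewrite scale1r.
    * by rewrite mulmxV.
    * by move=> g gB; apply: XO; apply: isometry_OV.
    by exists a, b, c; split=> //; right.
  + by right; split=> // g gB; rewrite GGE; apply: isometry_OV.
have Bu : B \in unitmx by case: sB.
have isoG g : G g -> g *m B *m g^T = B.
  by move/sub; rewrite GGE => /(SpV_isometryE _ Bu).
exists (-1), B, (invmx B); split.
+ by split; [right|apply: symplectic_tr|rewrite mulmxV].
+ move=> X /trans; rewrite GGE => XO.
  have [||||a [b [c E]]] := @form_op_entries F d (-1) B (invmx B) d4 _ _ _ X.
  * by right.
  * exact: symplectic_tr.
  * by rewrite mulmxV.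
  * by move=> g gB; apply: XO; apply/SpV_isometryE.
  by exists a, b, c; split=> //; right.
by right; split=> // g gB; rewrite GGE; apply/SpV_isometryE.
Qed.

(** Vectors of V (x) V are read as matrices, so that pure tensors have rank at most one and ranks
    can be counted. *)
Definition untens (v : 'M[F]_(1 * 1, d * d)) : 'M[F]_d :=
  \matrix_(k, l) v 0 (mxtens_index (k, l)).

Lemma untens_tens (x y : 'rV[F]_d) : untens (x *t y) = x^T *m y.
Proof.
apply/matrixP => k l; rewrite !mxE big_ord1 !mxE mxtens_indexK /=.
by congr (x _ _ * y _ _); apply: val_inj; rewrite /= ?div0n ?mod0n // ord1.
Qed.

Lemma untens_std_op B C a b c X (x y : 'rV[F]_d) : std_op B C a b c X ->
  untens ((x *t y) *m X) =
  a *: (x^T *m y) + b *: (y^T *m x) + (c * bform B x y) *: C.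
Proof.
move=> E; apply/matrixP => k l; rewrite !mxE !big_ord1 sum_mxtens !mxE.
transitivity (\sum_i \sum_j (a * (((i == k)%:R * x 0 i) * ((j == l)%:R * y 0 j))
  + b * (((i == l)%:R * x 0 i) * ((j == k)%:R * y 0 j))
  + c * (x 0 i * B i j * y 0 j) * C k l)).
  apply: eq_bigr => i _; apply: eq_bigr => j _; rewrite E !mxE mxtens_indexK /=.
  rewrite !ord1.
  by ring.
have S2 u (p q : 'I_d -> F) : \sum_a \sum_b u * (p a * q b) =
    u * ((\sum_a p a) * (\sum_b q b)).
  rewrite mulr_suml mulr_sumr; apply: eq_bigr => i _.
  by rewrite -mulr_sumr -mulr_sumr.
under eq_bigr do rewrite !big_split.
rewrite !big_split /= !S2 !sum_delta; congr (_ + _ + _).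
  by rewrite [x _ _ * _]mulrC.
rewrite /bform mxE exchange_big mulr_sumr mulr_suml; apply: eq_bigr => j _ /=.
rewrite -mulr_suml -mulr_sumr; congr (_ * _ * _).
by rewrite !mxE mulr_suml; apply: eq_bigr.
Qed.

Lemma rank_outer (x y : 'rV[F]_d) : (\rank (x^T *m y) <= 1)%N.
Proof. exact: leq_trans (mxrankM_maxr _ _) (rank_leq_row _). Qed.

(** [C] is invertible, so its nonzero multiples have rank d. This discards the contraction term
    whenever the remaining terms have small rank. *)
Lemma scale_full_rank B C e (c : F) n (Y : 'M[F]_d) : form_pair e B C ->
  (\rank Y <= n)%N -> (n < d)%N -> Y = c *: C -> c = 0 /\ Y = 0.
Proof.
move=> [_ _ BC] rY nd YE; have [c00|c0] := eqVneq c 0.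
  by rewrite YE c00 scale0r.
suff : (d <= n)%N by rewrite leqNgt nd.
apply: leq_trans rY; rewrite YE mxrank_scale_nz //.
by have [_ Cu] := mulmx1_unit BC; rewrite mxrank_unit.
Qed.

(** [A *t 1%:M] commutes with every [g *t g], hence is standard. On the tensor of two distinct basis
    vectors i and j, all terms but the contraction have total rank at most 3. *)
Lemma commutant_scalar G e B C A : (4 < d)%N -> form_pair e B C ->
  std_endT2 G B C -> (forall g, G g -> g *m A = A *m g) -> exists a, A = a%:M.
Proof.
move=> d4 fp std cA.
have [g Gg|a [b [c [E _]]]] := std (A *t 1%:M).
  by rewrite !tensmx_mul cA // mulmx1 mul1mx.
exists a; apply/matrixP => i k.
have [j nj] : exists j : 'I_d, j != i.
  have d2 : (1 < d)%N by apply: leq_trans d4.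
  pose i0 : 'I_d := Ordinal (ltnW d2); pose i1 : 'I_d := Ordinal d2.
  by have [->|?] := eqVneq i i0; [exists i1|exists i0; rewrite eq_sym].
have := untens_std_op (delta_mx 0 i) (delta_mx 0 j) E.
rewrite tensmx_mul mulmx1 untens_tens => UE.
have [|||] := @scale_full_rank B C e (c * bform B (delta_mx 0 i) (delta_mx 0 j)) 3
  (((delta_mx 0 i : 'rV_d) *m A)^T *m delta_mx 0 j
  - a *: ((delta_mx 0 i : 'rV_d)^T *m delta_mx 0 j)
  - b *: ((delta_mx 0 j : 'rV_d)^T *m delta_mx 0 i)) fp.
- rewrite -!scaleNr !scalemxAl.
  apply: leq_trans (mxrank_add _ _) _; rewrite -[3%N]/(2 + 1)%N leq_add //.
    apply: leq_trans (mxrank_add _ _) _; rewrite -[2%N]/(1 + 1)%N leq_add //;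
    exact: leq_trans (mxrankM_maxr _ _) (rank_leq_row _).
  exact: leq_trans (mxrankM_maxr _ _) (rank_leq_row _).
- exact: leq_trans d4.
- by rewrite UE; apply/matrixP => s t; rewrite !mxE; ring.
(* The swap term lives in column i, so column j compares row i of [A] with a multiple of the basis
   vector i. *)
move=> _ /(congr1 (fun M : 'M_d => M k j)).
rewrite !mxE !big_ord1 !mxE !eqxx /= (negPf nj) !mulr0 subr0 !mulr1.
rewrite (bigD1 i) //= big1 ?addr0 => [|l nl]; last by rewrite mxE (negPf nl) mul0r.
rewrite mxE !eqxx mul1r => /eqP; rewrite subr_eq0 => /eqP ->.
by rewrite eq_sym; case: (i == k); rewrite ?mulr1 ?mulr0.
Qed.

End StandardOperators.

(** * Exclusion of direct sum and tensor decompositions *)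

Section NoInvariantStructure.

Variables (F : numFieldType) (d : nat) (G : set 'M[F]_d).
Variables (e : F) (B C : 'M[F]_d).
Hypotheses (d_gt4 : (4 < d)%N) (fp : form_pair e B C) (std : std_endT2 G B C).

(** For nonzero u, v in two different summands, [X] kills [u *t v] and fixes [u *t u]. The first
    fact forces a = b = 0; by the second, the rank-one matrix [u^T *m u] is then a multiple of
    [C]. *)
Lemma std_endT2_no_sum : ~ preserves_sum_decomposition G.
Proof.
case=> t [W [t2 W0 sumW dxW permW]].
pose W' i := (\sum_(j | j != i) W j)%MS.
have dx i : (W i :&: W' i = 0)%MS.
  by have /mxdirect_sumsP/(_ i isT) := dxW.
pose P i := proj_mx (W i) (W' i).
have P_id i (u : 'rV_d) : (u <= W i)%MS -> u *m P i = u.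
  by move=> ui; rewrite proj_mx_id ?dx.
have P_0 i j (u : 'rV_d) : i != j -> (u <= W j)%MS -> u *m P i = 0.
  move=> ij uj; rewrite proj_mx_0 ?dx // (submx_trans uj) //.
  by rewrite (sumsmx_sup j) // eq_sym.
clearbody P; pose i0 : 'I_t := Ordinal (ltnW t2); pose i1 : 'I_t := Ordinal t2.
have [u /andP[u0 uW]] : exists u : 'rV_d, (u != 0) && (u <= W i0)%MS.
  by exists (nz_row (W i0)); rewrite nz_row_eq0 W0 nz_row_sub.
have [v /andP[v0 vW]] : exists v : 'rV_d, (v != 0) && (v <= W i1)%MS.
  by exists (nz_row (W i1)); rewrite nz_row_eq0 W0 nz_row_sub.
pose X := \sum_i (P i *t P i).
have [g Gg|a [b [c [E _]]]] := std (X := X).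
  have [s sE] := permW g Gg.
  have Pg i : P i *m g = g *m P (s i).
    apply/row_matrixP => k; rewrite !row_mul !rowE.
    have : ((delta_mx 0 k : 'rV[F]_d) <= (\sum_i W i)%MS)%MS by rewrite sumW submx1.
    case/sub_sumsmxP => w ->; rewrite !mulmx_suml; apply: eq_bigr => j _.
    have wj : (w j *m W j <= W j)%MS by apply: submxMl.
    have wg : (w j *m W j *m g <= W (s j))%MS by rewrite -sE submxMr.
    have [->|ij] := eqVneq i j; first by rewrite (P_id j) // (P_id (s j)).
    by rewrite (P_0 i j) // mul0mx (P_0 _ (s j)) // (inj_eq perm_inj).
  rewrite /X mulmx_sumr mulmx_suml [LHS](reindex_inj (@perm_inj _ s)) /=.
  by apply: eq_bigr => i _; rewrite !tensmx_mul Pg.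
have XE (x y : 'rV_d) :
    untens (\sum_i ((x *m P i) *t (y *m P i))) = untens ((x *t y) *m X).
  congr untens; rewrite /X mulmx_sumr; apply: eq_bigr => i _.
  by rewrite tensmx_mul.
have uv0 : untens ((u *t v) *m X) = 0.
  rewrite -XE big1 => [|i _]; first by apply/matrixP => k l; rewrite !mxE.
  have [->|ni] := eqVneq i i0; first by rewrite (P_0 i0 i1 v) // tensmx0.
  by rewrite (P_0 i i0 u) // tens0mx.
have uu : untens ((u *t u) *m X) = u^T *m u.
  rewrite -XE (bigD1 i0) //= big1 ?addr0 => [|i ni]; last first.
    by rewrite (P_0 i i0 u) // tens0mx.
  by rewrite P_id // untens_tens.
rewrite (untens_std_op _ _ E) in uv0; rewrite (untens_std_op _ _ E) in uu.
have [_ ab0] : c * bform B u v = 0 /\ a *: (u^T *m v) + b *: (v^T *m u) = 0.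
  have [|||c0 ab0] := @scale_full_rank _ _ B C e (- (c * bform B u v)) 2
    (a *: (u^T *m v) + b *: (v^T *m u)) fp.
  - apply: leq_trans (mxrank_add _ _) _; rewrite -[2%N]/(1 + 1)%N leq_add //;
    exact: leq_trans (mxrank_scale _ _) (rank_outer _ _).
  - by apply: leq_trans d_gt4.
  - by apply/eqP; rewrite scaleNr -addr_eq0 uv0.
  by split=> //; apply/eqP; rewrite -oppr_eq0 c0.
have nz (x y : 'rV[F]_d) : x != 0 -> y != 0 -> x^T *m y != 0.
  move=> /rV0Pn[k xk] /rV0Pn[l yl]; apply/eqP => /matrixP/(_ k l).
  by rewrite !mxE big_ord1 !mxE => /eqP; rewrite mulf_eq0 (negPf xk) (negPf yl).
(* The projections onto the two summands separate the terms [u^T *m v] and [v^T *m u]. *)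
have a0 : a = 0.
  have := congr1 (mulmxr (P i1)) ab0; rewrite /= mul0mx mulmxDl -!scalemxAl.
  rewrite -!mulmxA (P_id i1 v) // (P_0 i1 i0 u) // mulmx0 scaler0 addr0 => /eqP.
  by rewrite scaler_eq0 (negPf (nz _ _ u0 v0)) orbF => /eqP.
have b0 : b = 0.
  have := congr1 (mulmxr (P i0)) ab0; rewrite /= mul0mx mulmxDl -!scalemxAl.
  rewrite -!mulmxA (P_id i0 u) // (P_0 i0 i1 v) // mulmx0 scaler0 add0r => /eqP.
  by rewrite scaler_eq0 (negPf (nz _ _ v0 u0)) orbF => /eqP.
rewrite a0 b0 !scale0r !add0r in uu.
have [_ uu0] := scale_full_rank fp (rank_outer u u) (ltnW (ltnW (ltnW d_gt4))) (esym uu).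
by have := nz _ _ u0 u0; rewrite uu0 eqxx.
Qed.

Lemma rank_sum_le n (A : 'I_n -> 'M[F]_d) :
  (forall i, \rank (A i) <= 1)%N -> (\rank (\sum_i A i)%R <= n)%N.
Proof.
elim: n A => [|n IH] A A1; first by rewrite big_ord0 mxrank0.
rewrite big_ord_recl; apply: leq_trans (mxrank_add _ _) _.
by rewrite -[X in (_ <= X)%N]add1n leq_add // IH.
Qed.

(** For index functions [f0] and [f1] that differ everywhere, [X] sends [E f0 *t E f1] to a sum of m
    partially swapped tensors. Since m >= 2, such a tensor is neither the original one nor its full
    swap. *)
Lemma std_endT2_no_tensor : ~ preserves_tensor_structure G.
Proof.
case=> m [n [E [m2 n2 basE actE]]].
pose I := {dffun forall i : 'I_m, 'I_(n i)}.
(* Sending (f, h) to [(swap f h j, swap h f j)] exchanges the j-th tensor factors. *)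
pose swap (f h : I) (j : 'I_m) : I := [ffun i => if i == j then h i else f i].
pose M : 'M[F]_(#|{: I}|, d) := \matrix_i E (enum_val i).
have cardI : #|{: I}| = d.
  have bE : basis_of fullv (codom_tuple E) by [].
  by have := size_basis bE; rewrite dimvf dim_matrix mul1r => ->.
have ME (i : 'I_#|{: I}|) : (codom_tuple E)`_i = E (enum_val i).
  by rewrite /= codomE (nth_map (enum_val i)) -?cardE // -enum_val_nth.
have freeM : row_free M.
  have /andP[_ fE] := basE.
  rewrite -kermx_eq0; apply/rowV0P => u /sub_kermxP uM.
  have /freeP fr : free (codom_tuple E) by [].
  apply/rowP => i; rewrite mxE; apply: (fr (fun i => u 0 i)); rewrite -[RHS]uM.
  by rewrite mulmx_sum_row; apply: eq_bigr => j _; rewrite ME rowK.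
have fullM : row_full M by apply/eqP; rewrite -[RHS]cardI; apply/eqP.
(* The dual basis of [E]. *)
pose ph (f : I) : 'cV[F]_d := col (enum_rank f) (pinvmx M).
have Eph f h : E f *m ph h = (f == h)%:R%:M.
  have -> : E f = row (enum_rank f) M by rewrite rowK enum_rankK.
  apply/matrixP => i j; rewrite !ord1 [RHS]mxE eqxx mulr1n.
  have := congr1 (fun A : 'M_#|{: I}| => A (enum_rank f) (enum_rank h)) (mulmxVp freeM).
  rewrite !mxE (inj_eq enum_rank_inj) => <-.
  by apply: eq_bigr => k _; rewrite !mxE.
have one_ph : 1%:M = \sum_f ph f *m E f.
  rewrite -(mulVpmx fullM); apply/matrixP => i j; rewrite summxE mxE.
  rewrite (reindex enum_rank) /=; last first.
    by exists enum_val => ? _; rewrite (enum_rankK, enum_valK).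
  by apply: eq_bigr => f _; rewrite !mxE big_ord1 !mxE enum_rankK.
pose Z (f h : I) : 'M[F]_(1 * 1, d * d) :=
  \sum_j E (swap f h j) *t E (swap h f j).
pose X := \sum_f \sum_h (ph f *t ph h) *m Z f h.
have EX f h : (E f *t E h) *m X = Z f h.
  rewrite /X mulmx_sumr (bigD1 f) //= [X in _ + X]big1 ?addr0; last first.
    move=> f' /negPf nf; rewrite mulmx_sumr big1 // => h' _.
    by rewrite mulmxA tensmx_mul Eph eq_sym nf raddf0 tens0mx mul0mx.
  rewrite mulmx_sumr (bigD1 h) //= [X in _ + X]big1 ?addr0; last first.
    move=> h' /negPf nh.
    by rewrite mulmxA tensmx_mul !Eph [h == h']eq_sym nh raddf0 tensmx0 mul0mx.
  by rewrite mulmxA tensmx_mul !Eph !eqxx tensmx11 mul1mx.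
clearbody X.
have tensE (a b : I -> F) : (\sum_k a k *: E k) *t (\sum_l b l *: E l) =
    \sum_(p : I * I) (a p.1 * b p.2) *: (E p.1 *t E p.2).
  rewrite -(pair_bigA _ (fun k l => (a k * b l) *: (E k *t E l))) /=.
  apply/matrixP => i j; rewrite !mxE !summxE mulr_suml; apply: eq_bigr => k _.
  rewrite summxE mulr_sumr; apply: eq_bigr => l _; rewrite !mxE; ring.
have comX g : G g -> (g *t g) *m X = X *m (g *t g).
  case/actE => s [A [_ gA]].
  pose c (f k : I) : F := \prod_i A i (f (s i)) (k i).
  have Eg f : E f *m g = \sum_k c f k *: E k.
    have -> : E f = pure_tensor E (fun i => delta_mx 0 (f i)).
      rewrite /pure_tensor (bigD1 f) //= [X in _ + X]big1 ?addr0.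
        by rewrite big1 ?scale1r // => i _; rewrite mxE !eqxx.
      move=> k nk; have [i ki] : exists i, k i != f i.
        apply/existsP; apply: contraNT nk => /existsPn nk.
        by apply/eqP/ffunP => i; apply/eqP; have := nk i; rewrite negbK.
      by rewrite (bigD1 i) //= mxE (negPf ki) andbF mul0r scale0r.
    rewrite gA; apply: eq_bigr => k _; congr (_ *: _).
    by apply: eq_bigr => i _; rewrite -rowE mxE.
  have swapK (j : 'I_m) : involutive (fun p : I * I => (swap p.1 p.2 j, swap p.2 p.1 j)).
    move=> [k l] /=; congr pair; apply/ffunP => i; rewrite !ffunE;
    by case: eqP => // ->; rewrite ffunE eqxx.
  have comE f h : (E f *t E h) *m ((g *t g) *m X) = (E f *t E h) *m (X *m (g *t g)).
    rewrite !mulmxA EX tensmx_mul !Eg tensE mulmx_suml /Z mulmx_suml.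
    transitivity (\sum_p \sum_j (c f p.1 * c h p.2) *:
        (E (swap p.1 p.2 j) *t E (swap p.2 p.1 j))).
      by apply: eq_bigr => p _; rewrite -scalemxAl EX scaler_sumr.
    (* The element g carries the factor [s j] to position j, so a swap at [s j] before g is a swap
       at j after g. *)
    rewrite exchange_big [RHS](reindex_inj (@perm_inj _ s)) /=.
    apply: eq_bigr => j _; rewrite tensmx_mul !Eg tensE.
    rewrite [RHS](reindex_inj (inv_inj (swapK j))) /=; apply: eq_bigr => -[k l] _.
    congr (_ *: _); rewrite /= /c -!big_split; apply: eq_bigr => i _.
    by rewrite !ffunE (inj_eq perm_inj); case: eqP => _ //=; rewrite mulrC.
  rewrite -[LHS]mul1mx -[RHS]mul1mx -(tensmx11 F d) !one_ph.
  have -> : (\sum_f ph f *m E f) *t (\sum_f ph f *m E f) =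
      \sum_f \sum_h (ph f *t ph h) *m (E f *t E h).
    apply/matrixP => i j; rewrite !mxE !summxE mulr_suml.
    apply: eq_bigr => f _; rewrite summxE mulr_sumr; apply: eq_bigr => h _.
    by rewrite tensmx_mul [RHS]mxE.
  rewrite !mulmx_suml; apply: eq_bigr => f _; rewrite !mulmx_suml.
  by apply: eq_bigr => h _; rewrite -!mulmxA comE.
have [a [b [c0 [stdX _]]]] := std comX.
pose f0 : I := [ffun i => Ordinal (ltnW (n2 i))].
pose f1 : I := [ffun i => Ordinal (n2 i)].
have f01 i : (f0 i == f1 i) = false by rewrite !ffunE.
have := untens_std_op (E f0) (E f1) stdX; rewrite EX => UE.
have UZ : untens (Z f0 f1) =
    \sum_j (E (swap f0 f1 j))^T *m E (swap f1 f0 j).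
  rewrite /Z; apply/matrixP => k l; rewrite mxE !summxE; apply: eq_bigr => j _.
  by rewrite -untens_tens [RHS]mxE.
(* The bound counts the m partial swaps and the two terms with coefficients a and b. It follows from
   2^m <= d for m >= 3, and is the hypothesis d > 4 for m = 2. *)
have m_small : (m + 2 < d)%N.
  have leI : (2 ^ m <= d)%N.
    rewrite -cardI -{1}(card_ord m) -[2%N]card_bool -card_ffun.
    pose em (b : {ffun 'I_m -> bool}) : I := [ffun i => if b i then f1 i else f0 i].
    apply: (leq_card em) => b1 b2 /ffunP eb; apply/ffunP => i.
    have := eb i; rewrite !ffunE => /(congr1 val) /=.
    by case: (b1 i); case: (b2 i).
  have [->|m3] := eqVneq m 2; first by [].
  have {}m3 : (2 < m)%N by rewrite ltn_neqAle eq_sym m3.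
  apply: leq_trans leI; rewrite -(subnK m3); elim: (m - 3)%N => // k IH.
  by rewrite addSn expnS; lia.
have [||c00 Z0] := @scale_full_rank _ _ B C e (c0 * bform B (E f0) (E f1)) (m + 2)
    (untens (Z f0 f1) - a *: ((E f0)^T *m E f1) - b *: ((E f1)^T *m E f0)) fp _ m_small _.
- rewrite -addrA; apply: leq_trans (mxrank_add _ _) _; rewrite leq_add //.
    by rewrite UZ rank_sum_le // => i; apply: rank_outer.
  apply: leq_trans (mxrank_add _ _) _; rewrite -[2%N]/(1 + 1)%N.
  by rewrite -!scaleNr leq_add // (leq_trans (mxrank_scale _ _)) // rank_outer.
- by rewrite UE; apply/matrixP => s t; rewrite !mxE; ring.
pose j0 : 'I_m := Ordinal (ltnW m2); pose j1 : 'I_m := Ordinal m2.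
have dual f h : (ph h)^T *m (E f)^T = (f == h)%:R%:M.
  by rewrite -trmx_mul Eph tr_scalar_mx.
have ne0 : (f0 == swap f0 f1 j0) = false.
  by apply/negP => /eqP/ffunP/(_ j0)/eqP; rewrite [X in _ == X]ffunE eqxx f01.
have ne1 : (f1 == swap f0 f1 j0) = false.
  by apply/negP => /eqP/ffunP/(_ j1)/eqP; rewrite [X in _ == X]ffunE eq_sym f01.
(* Pairing with this dual vector leaves the partial swap at [j0] alone, so a basis vector would
   vanish. *)
have := congr1 (mulmx (ph (swap f0 f1 j0))^T) Z0.
rewrite !mulmxBr mulmx0 -!scalemxAr !mulmxA !dual ne0 ne1 !raddf0 !mul0mx !scaler0.
rewrite !subr0 UZ mulmx_sumr (bigD1 j0) //= big1 ?addr0 => [|j nj].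
  rewrite mulmxA dual eqxx mul1mx => E0.
  have := Eph (swap f1 f0 j0) (swap f1 f0 j0).
  rewrite E0 mul0mx eqxx => /matrixP/(_ 0 0)/eqP.
  by rewrite !mxE eq_sym oner_eq0.
rewrite mulmxA dual; have -> : (swap f0 f1 j == swap f0 f1 j0) = false.
  apply/negP => /eqP/ffunP/(_ j0)/eqP.
  by rewrite !ffunE eqxx [j0 == j]eq_sym (negPf nj) -!val_eqE.
by rewrite raddf0 mul0mx.
Qed.

End NoInvariantStructure.

(** * Averages over conjugation and Schur orthogonality *)

Section ConjugationAverages.

Variables (F : numFieldType) (d : nat) (gT : finGroupType) (G : {group gT}).
Variable rG : mx_representation F G d.
Implicit Types (M A : 'M[F]_d) (L N : {group gT}) (X : 'M[F]_(d * d)).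

(** The linear extension of [A *t A'] |-> (M |-> [A *m M *m A']). It turns sums of x (x) x^-1 into
    sums of conjugates. *)
Definition sandwich X M : 'M[F]_d :=
  \matrix_(i, l) \sum_k \sum_j X (mxtens_index (i, j)) (mxtens_index (k, l)) * M k j.

Lemma sandwich_tens A A' M : sandwich (A *t A') M = A *m M *m A'.
Proof.
apply/matrixP => i l; rewrite !mxE exchange_big /=; apply: eq_bigr => j _.
by rewrite mxE mulr_suml; apply: eq_bigr => k _; rewrite tensmxE mulrAC.
Qed.

Lemma sandwich_sum (I : finType) (P : pred I) (X : I -> 'M[F]_(d * d)) M :
  sandwich (\sum_(i | P i) X i) M = \sum_(i | P i) sandwich (X i) M.
Proof.
apply/matrixP => i l; rewrite mxE summxE.
under [RHS]eq_bigr do rewrite mxE.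
rewrite [RHS]exchange_big; apply: eq_bigr => k _.
rewrite [RHS]exchange_big; apply: eq_bigr => j _.
by rewrite summxE mulr_suml.
Qed.

(** The adjoint for the form when [C] is inverse to [B]: [bform B (u *m adj B C M) v = bform B u (v
    *m M)]. *)
Definition adj (B C : 'M[F]_d) M := B *m M^T *m C.

Lemma sandwich_std B C a b c X M : std_op B C a b c X ->
  sandwich X M = a *: M + (b * \tr M)%:M + c *: adj B C M.
Proof.
move=> E; apply/matrixP => i l; rewrite !mxE.
transitivity (\sum_k \sum_j ((k == i)%:R * (a * ((j == l)%:R * M k j))
   + b * (i == l)%:R * ((j == k)%:R * M k j) + c * (B i j * M k j * C k l))).
  apply: eq_bigr => k _; apply: eq_bigr => j _; rewrite E.
  by rewrite [k == i]eq_sym; ring.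
under eq_bigr do rewrite !big_split /= -!mulr_sumr !sum_delta.
rewrite !big_split /= -!mulr_sumr sum_delta; congr (_ + _ + c * _).
  by rewrite /mxtrace; case: (i == l); rewrite ?mulr1 ?mulr0 ?mul0r.
apply: eq_bigr => k _; rewrite -mulr_suml !mxE; congr (_ * _).
by apply: eq_bigr => j _; rewrite mxE.
Qed.

Definition ntr M : F := \tr M / d%:R.

Definition avg L M : 'M[F]_d :=
  #|L|%:R^-1 *: \sum_(x in L) rG x *m M *m rG x^-1%g.

Definition commutes M L := forall x, x \in L -> rG x *m M = M *m rG x.

Lemma card_neq0 L : #|L|%:R != 0 :> F.
Proof. by rewrite pnatr_eq0 -lt0n cardG_gt0. Qed.

Lemma avg_sum L M : \sum_(x in L) rG x *m M *m rG x^-1%g = #|L|%:R *: avg L M.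
Proof. by rewrite /avg scalerA divff ?card_neq0 ?scale1r. Qed.

Lemma repr_mxVl x : x \in G -> rG x^-1%g *m rG x = 1%:M.
Proof. by move=> Gx; rewrite -repr_mxM ?groupV // mulVg repr_mx1. Qed.

Lemma repr_mxVr x : x \in G -> rG x *m rG x^-1%g = 1%:M.
Proof. by move=> Gx; rewrite -repr_mxM ?groupV // mulgV repr_mx1. Qed.

Lemma avg_id L M : L \subset G -> commutes M L -> avg L M = M.
Proof.
move=> sLG cM; rewrite /avg (eq_bigr (fun _ => M)) => [|x Lx].
  by rewrite sumr_const -scaler_nat scalerA mulVf ?card_neq0 ?scale1r.
by rewrite cM // -mulmxA repr_mxVr ?mulmx1 // (fintype.subsetP sLG).
Qed.

Lemma avg_commutes L M : L \subset G -> commutes (avg L M) L.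
Proof.
move=> sLG y Ly; have Gy := fintype.subsetP sLG y Ly.
rewrite /avg -scalemxAr -scalemxAl; congr (_ *: _).
rewrite mulmx_sumr mulmx_suml [RHS](reindex_inj (mulgI y)) /=.
apply: eq_big => x; first by rewrite groupMl.
move=> Lx; have Gx := fintype.subsetP sLG x Lx.
rewrite invMg !repr_mxM ?groupM ?groupV // !mulmxA -[_ *m rG y^-1%g *m _]mulmxA.
by rewrite repr_mxVl // mulmx1.
Qed.

Lemma avg_commutes_other L N M : L \subset G ->
  (forall x, x \in L -> commutes (rG x) N) ->
  commutes M N -> commutes (avg L M) N.
Proof.
move=> sLG cLN cM y Ny; rewrite /avg -scalemxAr -scalemxAl; congr (_ *: _).
rewrite mulmx_sumr mulmx_suml; apply: eq_bigr => x Lx.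
rewrite !mulmxA cLN // -!mulmxA; congr (_ *m _); rewrite mulmxA cM // -!mulmxA.
by rewrite cLN ?groupV.
Qed.

Lemma mxtrace_avg L M : L \subset G -> \tr (avg L M) = \tr M.
Proof.
move=> sLG; rewrite /avg mxtraceZ raddf_sum /= (eq_bigr (fun _ => \tr M)).
  by rewrite sumr_const -[\tr M *+ _]mulr_natl mulrA mulVf ?card_neq0 ?mul1r.
move=> x Lx; rewrite -mulmxA mxtrace_mulC -mulmxA repr_mxVl ?mulmx1 //.
exact: (fintype.subsetP sLG).
Qed.

Lemma avgMr L M A : L \subset G -> commutes A L -> avg L (M *m A) = avg L M *m A.
Proof.
move=> sLG cA; rewrite /avg -scalemxAl mulmx_suml; congr (_ *: _).
by apply: eq_bigr => x Lx; rewrite -!mulmxA cA ?groupV.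
Qed.

Lemma avgMl L M A : L \subset G -> commutes A L -> avg L (A *m M) = A *m avg L M.
Proof.
move=> sLG cA; rewrite /avg -scalemxAr mulmx_sumr; congr (_ *: _).
by apply: eq_bigr => x Lx; rewrite !mulmxA cA.
Qed.

Lemma avgB L M A : avg L (M - A) = avg L M - avg L A.
Proof.
rewrite /avg -scalerBr -sumrB; congr (_ *: _); apply: eq_bigr => x _.
by rewrite mulmxBr mulmxBl.
Qed.

Lemma avgZ L a M : avg L (a *: M) = a *: avg L M.
Proof.
rewrite /avg scalerA mulrC -scalerA; congr (_ *: _); rewrite scaler_sumr.
by apply: eq_bigr => x _; rewrite -scalemxAr -scalemxAl.
Qed.

Lemma avgD L M A : avg L (M + A) = avg L M + avg L A.
Proof.
rewrite /avg -scalerDr -big_split; congr (_ *: _); apply: eq_bigr => x _.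
by rewrite mulmxDr mulmxDl.
Qed.

Lemma commutes_scalar L a : commutes a%:M L.
Proof. by move=> x _; rewrite scalar_mxC. Qed.

Lemma ntr_scalar a : (0 < d)%N -> ntr a%:M = a.
Proof.
by move=> d0; rewrite /ntr mxtrace_scalar -[a *+ d]mulr_natr mulfK // pnatr_eq0 -lt0n.
Qed.

Lemma scalar_ntr a M : (0 < d)%N -> M = a%:M -> M = (ntr M)%:M.
Proof. by move=> d0 ->; rewrite ntr_scalar. Qed.

(* Schur orthogonality, read off entrywise from the averages of matrix units. *)
Lemma schur_delta (I : finType) (P : pred I) (f g : I -> 'M[F]_d) s k l :
  (forall M, \sum_(i | P i) f i *m M *m g i = (s * \tr M)%:M) ->
  \sum_(i | P i) g i k l *: f i = s *: delta_mx l k.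
Proof.
move=> E; apply/matrixP => a b.
have := congr1 (fun M : 'M_d => M a l) (E (delta_mx b k)).
rewrite mxE summxE summxE => H.
transitivity (\sum_(i | P i) (f i *m delta_mx b k *m g i) a l).
  apply: eq_bigr => i _; rewrite mxE [RHS]mxE (bigD1 k) //= big1 ?addr0.
    rewrite mxE (bigD1 b) //= big1 ?addr0 => [|c /negPf cb].
      by rewrite !mxE !eqxx mulr1 mulrC.
    by rewrite mxE cb mulr0.
  move=> c /negPf ck; rewrite mxE big1 ?mul0r // => c' _.
  by rewrite mxE ck andbF mulr0.
rewrite H !mxE /mxtrace (bigD1 b) //= big1 ?addr0 => [|c /negPf cb].
  rewrite mxE eqxx /= [b == k]eq_sym [a == l]eq_sym eq_sym.
  by case: (l == a); case: (k == b); rewrite ?mulr1 ?mulr0 ?mulr1n ?mulr0n // [a == l]eq_sym.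
by rewrite mxE cb.
Qed.

Lemma schur_trace (I : finType) (P : pred I) (f g : I -> 'M[F]_d) s :
  (forall M, \sum_(i | P i) f i *m M *m g i = (s * \tr M)%:M) ->
  \sum_(i | P i) \tr (f i) * \tr (g i) = s * d%:R.
Proof.
move=> E; transitivity (\sum_k \tr (\sum_(i | P i) g i k k *: f i)).
  under [RHS]eq_bigr do rewrite raddf_sum /=.
  rewrite exchange_big; apply: eq_bigr => i _ /=.
  by rewrite {2}/mxtrace mulr_sumr; apply: eq_bigr => k _; rewrite mxtraceZ mulrC.
rewrite (eq_bigr (fun _ => s)) => [|k _].
  by rewrite sumr_const card_ord mulr_natr.
rewrite (schur_delta _ _ E) mxtraceZ /mxtrace (bigD1 k) //= big1 ?addr0.
  by rewrite mxE !eqxx mulr1.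
by move=> c /negPf ck; rewrite mxE ck.
Qed.

(** Absolute irreducibility of [L] for d > 0, phrased through Schur's lemma. *)
Definition scalar_commutant L := forall A, commutes A L -> exists a, A = a%:M.

Lemma avg_scalar L M : (0 < d)%N -> L \subset G -> scalar_commutant L ->
  avg L M = (ntr M)%:M.
Proof.
move=> d0 sLG scL; have [a E] := scL _ (avg_commutes M sLG).
by rewrite [LHS](scalar_ntr d0 E) /ntr mxtrace_avg.
Qed.

Lemma scalar_commutant_sum L M : (0 < d)%N -> L \subset G -> scalar_commutant L ->
  \sum_(x in L) rG x *m M *m rG x^-1%g = (#|L|%:R / d%:R * \tr M)%:M.
Proof.
move=> d0 sLG scL; rewrite avg_sum avg_scalar // scale_scalar_mx /ntr.
by rewrite mulrA mulrAC.
Qed.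

Lemma scalar_commutant_chi L : (0 < d)%N -> L \subset G -> scalar_commutant L ->
  \sum_(x in L) \tr (rG x) * \tr (rG x^-1%g) = #|L|%:R.
Proof.
move=> d0 sLG scL.
rewrite (schur_trace (s := #|L|%:R / d%:R)) => [|M].
  by rewrite divfK // pnatr_eq0 -lt0n.
exact: scalar_commutant_sum.
Qed.

(** By [schur_delta] every matrix unit is a combination of the [rG x], so [M *m delta_mx l k *m M']
    vanishes for all l and k. *)
Lemma scalar_commutant_prime L M M' : (0 < d)%N -> L \subset G ->
  scalar_commutant L -> (forall x, x \in L -> M *m rG x *m M' = 0) ->
  M = 0 \/ M' = 0.
Proof.
move=> d0 sLG scL H.
have D k l : M *m delta_mx l k *m M' = 0.
  have := schur_delta k l (fun A => scalar_commutant_sum A d0 sLG scL).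
  move/(congr1 (fun Y => M *m Y *m M')); rewrite mulmx_sumr mulmx_suml big1.
    rewrite -scalemxAr -scalemxAl => /esym/eqP; rewrite scaler_eq0 => /orP[|/eqP //].
    by rewrite mulf_eq0 invr_eq0 (negPf (card_neq0 L)) pnatr_eq0 -leqn0 leqNgt d0.
  by move=> x Lx; rewrite -scalemxAr -scalemxAl H // scaler0.
have [->|M0] := eqVneq M 0; [by left|right].
have [i [l Mil]] : exists i l, M i l != 0.
  apply: contrapT => H0; case/eqP: M0; apply/matrixP => i l; rewrite mxE.
  by apply: contrapT => /eqP ?; apply: H0; exists i, l.
apply/matrixP => k b; rewrite mxE; apply: (mulfI Mil); rewrite mulr0.
have := congr1 (fun Y : 'M_d => Y i b) (D k l); rewrite !mxE => <-.
rewrite (bigD1 k) //= big1 ?addr0 => [|c /negPf ck]; last first.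
  by rewrite mxE big1 ?mul0r // => c' _; rewrite mxE ck andbF mulr0.
rewrite mxE (bigD1 l) //= big1 ?addr0 => [|c /negPf cl].
  by rewrite !mxE !eqxx mulr1.
by rewrite mxE cl mulr0.
Qed.

(** The projection onto a submodule along a Maschke complement commutes with [L], hence is
    scalar. *)
Lemma scalar_commutant_irr L (sLG : L \subset G) : (0 < d)%N ->
  scalar_commutant L -> mx_irreducible (subg_repr rG sLG).
Proof.
move=> d0 scL; apply/mx_irrP; split=> // U modU U0.
have pL : ([pchar F]^'.-group L)%g by rewrite /pgroup pcharf'_nat card_neq0.
have [W modW defV dxUW] := mx_Maschke_pchar (subg_repr rG sLG) pL modU (submx1 U).
have dx : (U :&: W = 0)%MS by apply/mxdirect_addsP.
have [P [PU PW]] : exists P : 'M[F]_d,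
    (forall u : 'rV_d, (u <= U)%MS -> u *m P = u) /\
    (forall w : 'rV_d, (w <= W)%MS -> w *m P = 0).
  by exists (proj_mx U W); split=> u uU; [rewrite proj_mx_id|rewrite proj_mx_0].
have [|a PE] := scL P.
  move=> x Lx; apply/row_matrixP => i; rewrite !rowE !mulmxA.
  have : ((delta_mx 0 i : 'rV[F]_d) <= (U + W)%MS)%MS.
    by rewrite defV submx1.
  case/sub_addsmxP => -[u w] /= ->; rewrite !mulmxDl.
  have Ux : (u *m U *m rG x <= U)%MS.
    by rewrite (submx_trans (submxMr _ (submxMl _ _))) // (mxmoduleP modU).
  have Wx : (w *m W *m rG x <= W)%MS.
    by rewrite (submx_trans (submxMr _ (submxMl _ _))) // (mxmoduleP modW).
  by rewrite (PU (u *m U *m rG x)) // (PW (w *m W *m rG x)) //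
    (PU (u *m U)) ?submxMl // (PW (w *m W)) ?submxMl // mul0mx.
have [a0|a0] := eqVneq a 0.
  case/eqP: U0; apply/row_matrixP => i; rewrite row0 -[LHS]PU ?row_sub //.
  by rewrite PE a0 raddf0 mulmx0.
have W0 : W = 0.
  apply/row_matrixP => i; rewrite row0; apply/eqP.
  have := PW (row i W) (row_sub i W); rewrite PE mul_mx_scalar => /eqP.
  by rewrite scaler_eq0 (negPf a0).
by rewrite -sub1mx -defV W0 addsmx0.
Qed.

End ConjugationAverages.

(** * Normal subgroups are scalar or irreducible *)

Section NormalSubgroups.

Variables (F : numFieldType) (d : nat) (gT : finGroupType) (G : {group gT}).
Variable rG : mx_representation F G d.
Variables (e : F) (B C : 'M[F]_d).
Hypotheses (d_gt4 : (4 < d)%N) (fp : form_pair e B C).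
Hypothesis std : std_endT2 (repr_image rG) B C.
Implicit Types (M A : 'M[F]_d) (L N : {group gT}).

Let d_gt0 : (0 < d)%N. Proof. exact: leq_ltn_trans d_gt4. Qed.
Let BC : B *m C = 1%:M. Proof. by case: fp. Qed.
Let CB' : C *m B = 1%:M. Proof. exact: mulmx1C. Qed.
Let ee : e * e = 1. Proof. by case: fp => es _ _; apply: e_sqr. Qed.
Local Notation star := (adj B C).

Lemma adjM M A : star (M *m A) = star A *m star M.
Proof.
rewrite /adj trmx_mul !mulmxA -[_ *m C *m B]mulmxA CB' mulmx1.
by rewrite -!mulmxA.
Qed.

Lemma adjK M : star (star M) = M.
Proof.
have [es BT _] := fp.
rewrite /adj !trmx_mul trmxK (CT es BT BC) BT.
do 5!rewrite -?scalemxAl -?scalemxAr.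
by rewrite scalerA ee scale1r !mulmxA BC mul1mx -mulmxA BC mulmx1.
Qed.

Lemma adjZ a M : star (a *: M) = a *: star M.
Proof. by rewrite /adj linearZ /= -scalemxAr -scalemxAl. Qed.

Lemma adjB M A : star (M - A) = star M - star A.
Proof.
rewrite /adj; have -> : (M - A)^T = M^T - A^T by apply/matrixP => i j; rewrite !mxE.
by rewrite mulmxBr mulmxBl.
Qed.

Lemma adj_scalar a : star a%:M = a%:M.
Proof. by rewrite /adj tr_scalar_mx mul_mx_scalar -scalemxAl BC scalemx1. Qed.

Lemma adj_form S : star (B *m S) = e *: (B *m S^T).
Proof.
have [_ BT _] := fp.
by rewrite /adj trmx_mul BT -scalemxAr -scalemxAr -scalemxAl -!mulmxA BC mulmx1.
Qed.

Lemma adj_repr g : g \in G -> rG g *m B *m (rG g)^T = B ->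
  star (rG g) = rG g^-1%g.
Proof.
move=> Gg gB; have := repr_mxVl rG Gg; move/(congr1 (mulmxr (star (rG g)))).
rewrite /= mul1mx /adj => <-.
by rewrite -mulmxA !mulmxA -[_ *m rG g *m B *m _]mulmxA -[_ *m rG g *m _]mulmxA
  mulmxA -!mulmxA [rG g *m _]mulmxA [_ *m B *m _]mulmxA gB BC mulmx1.
Qed.

Lemma small_rank_scalar (Y : 'M[F]_d) s : (\rank Y < d)%N -> Y = s%:M -> Y = 0.
Proof.
move=> rY YE; have [s0|s0] := eqVneq s 0; first by rewrite YE s0 raddf0.
by move: rY; rewrite YE -scalemx1 mxrank_scale_nz // mxrank1 ltnn.
Qed.

(** Source of test matrices: [B *m sgn_elem s p q] has rank at most 2 and, when s^2 = 1, is an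
    eigenvector of the adjoint with eigenvalue [e * s]. *)
Definition sgn_elem (s : F) p q : 'M[F]_d := delta_mx p q + s *: delta_mx q p.

Lemma rank_sgn_elem s p q : (\rank (B *m sgn_elem s p q) <= 2)%N.
Proof.
apply: leq_trans (mxrankM_maxr _ _) _; apply: leq_trans (mxrank_add _ _) _.
rewrite mxrank_delta (@leq_add _ _ 1 1) //.
by apply: leq_trans (mxrank_scale _ _) _; rewrite mxrank_delta.
Qed.

Lemma sgn_elem_nz s p q : p != q -> B *m sgn_elem s p q != 0.
Proof.
move=> pq; apply/eqP => E; have : C *m (B *m sgn_elem s p q) = 0 by rewrite E mulmx0.
rewrite mulmxA CB' mul1mx => /matrixP/(_ p q)/eqP.
by rewrite !mxE !eqxx (negPf pq) mulr0 addr0 oner_eq0.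
Qed.

Lemma adj_sgn_elem s p q : s * s = 1 ->
  star (B *m sgn_elem s p q) = (e * s) *: (B *m sgn_elem s p q).
Proof.
move=> ss; rewrite adj_form -scalerA; congr (_ *: _); rewrite scalemxAr.
congr (_ *m _); rewrite /sgn_elem; apply/matrixP => i j; rewrite !mxE.
rewrite [in RHS]mulrDr mulrA ss mul1r addrC.
by rewrite [(j == q) && _]andbC [(j == p) && _]andbC.
Qed.

Lemma sgn_elem_mul s p q r t :
  sgn_elem s p q *m B *m sgn_elem s r t =
  B q r *: delta_mx p t + (s * B q t) *: delta_mx p r +
  (s * B p r) *: delta_mx q t + (s * s * B p t) *: delta_mx q r.
Proof.
rewrite /sgn_elem !(mulmxDl, mulmxDr); do 6!rewrite -?scalemxAl -?scalemxAr.
rewrite !mulmx_delta !scalerA.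
move: (delta_mx p t) (delta_mx p r) (delta_mx q t) (delta_mx q r) => *.
by apply/matrixP => i j; rewrite !mxE; ring.
Qed.

Lemma form_neq0 : B <> 0.
Proof.
move=> B0; have := BC; rewrite B0 mul0mx => /matrixP/(_ (Ordinal d_gt0) (Ordinal d_gt0)).
by rewrite !mxE eqxx => /eqP; rewrite eq_sym oner_eq0.
Qed.

(** Conjugation by g permutes the terms. A stable family is allowed, not only one normal subgroup,
    so that a whole class of conjugate subgroups can be averaged. *)
Lemma conj_sum_endT2 (Ls : {set {group gT}}) :
    (forall L, L \in Ls -> L \subset G) ->
    (forall L g, g \in G -> L \in Ls -> (L :^ g)%G \in Ls) ->
  endT2 (repr_image rG) (\sum_(L in Ls) \sum_(x in L) rG x *t rG x^-1%g).
Proof.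
move=> sLG Ls_conj _ [g Gg ->].
rewrite mulmx_sumr mulmx_suml.
have inj : injective (fun L : {group gT} => (L :^ g)%G).
  by move=> L L' /(congr1 (@gval _)) /= /conjsg_inj /val_inj.
have Lsg L : ((L :^ g)%G \in Ls) = (L \in Ls).
  apply/idP/idP => [LgLs|]; last exact: Ls_conj.
  have -> : L = ((L :^ g) :^ g^-1)%G by apply: val_inj; rewrite /= conjsgK.
  by apply: Ls_conj; rewrite ?groupV.
rewrite [LHS](reindex_inj inj) /=; apply: eq_big => L; first by rewrite Lsg.
move=> LgLs; have LLs : L \in Ls by rewrite -Lsg.
rewrite mulmx_sumr mulmx_suml [LHS](reindex_inj (conjg_inj g)) /=.
apply: eq_big => x; first by rewrite memJ_conjg.
rewrite memJ_conjg => Lx; have Gx := fintype.subsetP (sLG _ LLs) x Lx.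
rewrite !tensmx_mul -!repr_mxM ?groupV ?groupJ //.
by rewrite -conjVg /conjg !mulKVg.
Qed.

Lemma sandwich_conj_sum (Ls : {set {group gT}}) M :
  sandwich (\sum_(L in Ls) \sum_(x in L) rG x *t rG x^-1%g) M =
  \sum_(L in Ls) \sum_(x in L) rG x *m M *m rG x^-1%g.
Proof.
rewrite sandwich_sum; apply: eq_bigr => L _; rewrite sandwich_sum.
by apply: eq_bigr => x _; rewrite sandwich_tens.
Qed.

Lemma two_other_indices (q r : 'I_d) : exists p s,
  [/\ p != s, p != q, p != r, s != q & s != r].
Proof.
have : (1 < #|~: [set q; r]|)%N.
  have := cardsC [set q; r]; rewrite cards2 card_ord => cE.
  by move: cE d_gt4; case: (q != r) => /=; lia.
case/card_gt1P => p [s [pA sA ps]]; exists p, s.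
by move: pA sA; rewrite !inE !negb_or => /andP[-> ->] /andP[-> ->].
Qed.

(** The average over [N] is an idempotent M |-> a M + b tr M + c M^*. Modulo scalars it multiplies
    self-adjoint and skew-adjoint matrices by a + c and a - c; tested on matrices of small rank,
    both numbers are 0 or 1. Only a = c = 0 survives, and then the commutant of [N] is scalar. *)
Lemma normal_scalar_commutant N : (N <| G)%g ->
  (exists2 x, x \in N & forall a, rG x <> a%:M) -> scalar_commutant rG N.
Proof.
case/andP=> sNG nNG [x0 Nx0 nsc].
have nN0 := card_neq0 F N.
have [||a0 [b0 [c0 [E _]]]] := std (@conj_sum_endT2 [set N] _ _).
- by move=> L /set1P ->.
- by move=> L g Gg /set1P ->; rewrite inE; apply/eqP/val_inj; apply: (normsP nNG).
have [a [b [c P]]] : exists a b c, forall M,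
    avg rG N M = a *: M + (b * \tr M)%:M + c *: star M.
  exists (#|N|%:R^-1 * a0), (#|N|%:R^-1 * b0), (#|N|%:R^-1 * c0) => M.
  have := sandwich_std M E; rewrite sandwich_conj_sum big_set1 avg_sum.
  move/(congr1 (fun Y => #|N|%:R^-1 *: Y)); rewrite scalerA mulVf // scale1r => ->.
  by rewrite !scalerDr !scalerA scale_scalar_mx mulrA.
have Pid M : commutes rG M N -> avg rG N M = M by exact: avg_id.
have Pcom M : commutes rG (avg rG N M) N by exact: avg_commutes.
have comD M A : commutes rG M N -> commutes rG A N -> commutes rG (M - A) N.
  by move=> cM cA x Nx; rewrite mulmxBr mulmxBl cM ?cA.
have comM M A : commutes rG M N -> commutes rG A N -> commutes rG (M *m A) N.
  by move=> cM cA x Nx; rewrite mulmxA cM // -!mulmxA cA.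
have PE s p q : s * s = 1 -> avg rG N (B *m sgn_elem s p q) =
    (a + c * (e * s)) *: (B *m sgn_elem s p q) +
    (b * \tr (B *m sgn_elem s p q))%:M.
  by move=> ss; rewrite P adj_sgn_elem // scalerDl addrAC scalerA.
have eig s : s * s = 1 -> (a + c * (e * s) = 0) \/ (a + c * (e * s) = 1).
  move=> ss; set l := a + _.
  have [p [q [pq _ _ _ _]]] := two_other_indices (Ordinal d_gt0) (Ordinal d_gt0).
  set Y := B *m sgn_elem s p q.
  have E1 : avg rG N Y = l *: Y + (b * \tr Y)%:M by exact: PE.
  have := Pid _ (Pcom Y); rewrite E1 avgD avgZ E1 Pid => [E2|]; last first.
    exact: commutes_scalar.
  have E3 : (l * l - l) *: Y = (- (l * (b * \tr Y)))%:M.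
    move: (b * \tr Y) E2 => be; move: {+}Y => Z E2; apply/matrixP => i j.
    have := congr1 (fun M : 'M_d => M i j) E2; rewrite !mxE.
    move: (Z i j) => z; case: (i == j); rewrite ?mulr1n ?mulr0n => /eqP;
      rewrite -subr_eq0 => /eqP E3; apply/eqP; rewrite -subr_eq0; apply/eqP;
      by rewrite -[RHS]E3; ring.
  have ll : l * l - l = 0.
    apply: contrapT => /eqP nz; case/eqP: (sgn_elem_nz s pq).
    have E4 : (l * l - l) *: Y = 0.
      apply: small_rank_scalar E3; rewrite mxrank_scale_nz //.
      apply: leq_ltn_trans (rank_sgn_elem _ _ _) _; exact: leq_trans d_gt4.
    by move/eqP: E4; rewrite scaler_eq0 (negPf nz) => /eqP.
  move/eqP: ll; rewrite -[X in _ - X]mulr1 -mulrBr mulf_eq0 subr_eq0.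
  by case/orP => /eqP; [left|right].
have e2 : e * e = 1 by [].
have ne2 : (- e) * (- e) = 1 by rewrite mulrNN.
have comE s p q : s * s = 1 -> a + c * (e * s) = 1 ->
    commutes rG (B *m sgn_elem s p q) N.
  move=> ss l1; have := PE s p q ss; rewrite l1 scale1r => /(canLR (addrK _)) <-.
  by apply: comD; [exact: Pcom|exact: commutes_scalar].
have rk_lt (Y : 'M[F]_d) k : (\rank Y <= k)%N -> (k <= 4)%N -> (\rank Y < d)%N.
  by move=> rY k4; apply: leq_ltn_trans rY (leq_ltn_trans k4 d_gt4).
have rankM2 (Y Y' : 'M[F]_d) : (\rank Y' <= 2)%N -> (\rank (Y *m Y') <= 2)%N.
  exact: leq_trans (mxrankM_maxr _ _).
have half x y : x + y = 1 -> x - y = 0 -> x = 2%:R^-1 /\ y = 2%:R^-1 :> F.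
  move=> xy /eqP; rewrite subr_eq0 => /eqP E'; move: xy; rewrite E' -mulr2n => xy.
  by split; apply: (@mulfI _ 2%:R); rewrite ?pnatr_eq0 // mulr_natl xy mulfV ?pnatr_eq0.
have := eig (- e) ne2; have := eig e e2; rewrite mulrN e2 mulr1 mulrN1.
case=> l1; case=> l2.
- have [a00 c00] : a = 0 /\ c = 0.
    have : a + a = 0 by rewrite -[RHS](addr0 0) -{1}l1 -l2; ring.
    rewrite -mulr2n => /eqP; rewrite mulrn_eq0 /= => /eqP a00; split=> //.
    by rewrite -l1 a00 add0r.
  move=> A /Pid; rewrite P a00 c00 !scale0r addr0 add0r => <-.
  by exists (b * \tr A).
(* Here the skew-adjoint K commute with [N]. The self-adjoint matrix K^2 equals its average, a
   scalar; having rank at most 2 it vanishes, and its entries give B = 0. *)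
- have [aE cE] : a = 2%:R^-1 /\ c = - 2%:R^-1.
    have [||-> E'] := half a (- c); rewrite ?opprK //.
    by rewrite -E' opprK.
  have KK p q : p != q -> sgn_elem (- e) p q *m B *m sgn_elem (- e) p q = 0.
    move=> pq; set K := B *m sgn_elem (- e) p q.
    have cK : commutes rG K N by apply: comE; rewrite // mulrN e2 mulrN1.
    have sK : star K = - K by rewrite adj_sgn_elem // mulrN e2 scaleN1r.
    have sKK : star (K *m K) = K *m K by rewrite adjM sK mulNmx mulmxN opprK.
    have := Pid _ (comM _ _ cK cK); rewrite P sKK aE cE scaleNr addrAC subrr add0r.
    move/esym=> E3; have : K *m K = 0.
      apply: small_rank_scalar E3; apply: (rk_lt _ 2) => //.
      exact/rankM2/rank_sgn_elem.
    by move/(congr1 (mulmx C)); rewrite mulmx0 /K !mulmxA CB' mul1mx.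
  case: form_neq0; apply/matrixP => q p; rewrite mxE.
  have [pq|pq] := eqVneq p q.
    rewrite pq; have [p' [_ [_ p'q _ _ _]]] := two_other_indices q q.
    have := KK q p'; rewrite eq_sym => /(_ p'q)/matrixP/(_ p' p')/eqP.
    rewrite sgn_elem_mul !mxE !eqxx (negPf p'q) !andbF /= !mulr0 !add0r mulr1 addr0.
    have [es _ _] := fp; rewrite mulf_eq0 oppr_eq0 (negPf (e_neq0 es)) /=.
    by move/eqP.
  have := KK p q pq => /matrixP/(_ p q)/eqP.
  rewrite sgn_elem_mul !mxE !eqxx (negPf pq) [q == p]eq_sym (negPf pq) !andbF /=.
  by rewrite !mulr0 !addr0 mulr1 => /eqP.
(* Here the self-adjoint K, K' commute with [N]. Averaging K K' shows that K K' - K' K is scalar,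
   hence 0 since its rank is at most 4; a suitable entry of this relation is [B q r]. *)
- have [aE cE] := half a c l1 l2.
  have SS p q r s : sgn_elem e p q *m B *m sgn_elem e r s =
      sgn_elem e r s *m B *m sgn_elem e p q.
    set K := B *m sgn_elem e p q; set K' := B *m sgn_elem e r s.
    have cK : commutes rG K N by apply: comE; rewrite // e2 mulr1.
    have cK' : commutes rG K' N by apply: comE; rewrite // e2 mulr1.
    have sK : star K = K by rewrite adj_sgn_elem // e2 scale1r.
    have sK' : star K' = K' by rewrite adj_sgn_elem // e2 scale1r.
    have := Pid _ (comM _ _ cK cK'); rewrite P adjM sK sK' aE cE => E'.
    have E3 : K *m K' - K' *m K = (2%:R * (b * \tr (K *m K')))%:M.
      have n2 : 2%:R != 0 :> F by rewrite pnatr_eq0.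
      move: E'; move: (b * _) => be; move: (K *m K') (K' *m K) => U V E'.
      apply/matrixP => i j; have := congr1 (fun Y : 'M_d => Y i j) E'.
      rewrite !mxE; move: (U i j) (V i j) => u v.
      case: (i == j); rewrite ?mulr1n ?mulr0n => /eqP; rewrite -subr_eq0 => /eqP E3;
        apply/eqP; rewrite -subr_eq0; apply/eqP;
        (transitivity (- 2%:R * 0 : F); [rewrite -[in RHS]E3; by field|by rewrite mulr0]).
    have E4 : K *m K' - K' *m K = 0.
      apply: small_rank_scalar E3; apply: (rk_lt _ 4) => //.
      apply: leq_trans (mxrank_add _ _) _.
      by rewrite mxrank_opp (@leq_add _ _ 2 2) // rankM2 ?rank_sgn_elem.
    have /(congr1 (mulmx C)) : K *m K' = K' *m K by apply/eqP; rewrite -subr_eq0 E4.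
    by rewrite /K /K' !mulmxA CB' !mul1mx.
  case: form_neq0; apply/matrixP => q r; rewrite mxE.
  have [p [s [ps pq pr sq sr]]] := two_other_indices q r.
  have := SS p q r s; rewrite !sgn_elem_mul => /matrixP/(_ p s)/eqP.
  rewrite !mxE !eqxx (negPf pq) (negPf pr) (negPf ps) (negPf sr) !andbF /=.
  by rewrite !mulr0 !addr0 mulr1 => /eqP.
(* Here every matrix commutes with [N], which then consists of scalars. *)
have [a1 c1] : a = 1 /\ c = 0.
  have c00 : c = 0.
    have : c + c = 0 by rewrite -(subrr 1) -{1}l1 -l2; ring.
    by rewrite -mulr2n => /eqP; rewrite mulrn_eq0 /= => /eqP.
  by rewrite -l1 c00 addr0.
have cAll M : commutes rG M N.
  have := P M; rewrite a1 c1 scale1r scale0r addr0 => /(canLR (addrK _)) <-.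
  by apply: comD; [exact: Pcom|exact: commutes_scalar].
case: (nsc (rG x0 (Ordinal d_gt0) (Ordinal d_gt0))).
have sc i j k : rG x0 i j = rG x0 k k *+ (i == j).
  have := congr1 (fun Y : 'M_d => Y i k) (cAll (delta_mx j k) x0 Nx0).
  rewrite !mxE (bigD1 j) //= big1 ?addr0 => [|l /negPf lj]; last first.
    by rewrite mxE lj mulr0.
  rewrite (bigD1 k) //= big1 ?addr0 => [|l /negPf lk]; last first.
    by rewrite mxE lk andbF mul0r.
  rewrite !mxE !eqxx mulr1 => ->.
  by case: (i == j); rewrite ?mul1r ?mul0r.
by apply/matrixP => i j; rewrite !mxE (sc i j (Ordinal d_gt0)).
Qed.

End NormalSubgroups.

(** * Families of commuting conjugate subgroups have one member *)

Section CommutingConjugates.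

Variables (F : numFieldType) (d : nat) (gT : finGroupType) (G : {group gT}).
Variable rG : mx_representation F G d.
Variables (e : F) (B C : 'M[F]_d).
Hypotheses (d_gt4 : (4 < d)%N) (fp : form_pair e B C).
Hypothesis std : std_endT2 (repr_image rG) B C.
Hypothesis fG : mx_faithful rG.
Implicit Types (M A : 'M[F]_d) (L N : {group gT}).

Variables (Ls : {set {group gT}}) (q : nat).
Hypothesis Ls_sub : forall L, L \in Ls -> L \subset G.
Hypothesis Ls_conj : forall L g, g \in G -> L \in Ls -> (L :^ g)%G \in Ls.
Hypothesis Ls_com : forall L L', L \in Ls -> L' \in Ls -> L != L' ->
  (L' \subset 'C(L))%g.
Hypothesis Ls_nab : forall L, L \in Ls -> ~~ abelian L.
Hypothesis Ls_card : forall L, L \in Ls -> #|L| = q.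

Let d_gt0 : (0 < d)%N. Proof. exact: leq_ltn_trans d_gt4. Qed.
Let BC : B *m C = 1%:M. Proof. by case: fp. Qed.
Let dF : d%:R != 0 :> F. Proof. by rewrite pnatr_eq0 -lt0n. Qed.
Local Notation star := (adj B C).
Local Notation K := <<(\bigcup_(L in Ls) L)%SET>>%G.

Lemma faithful_inj x y : x \in G -> y \in G -> rG x = rG y -> x = y.
Proof.
move=> Gx Gy E; apply/eqP; rewrite eq_mulgV1; apply/eqP/set1P.
apply: (fintype.subsetP fG); apply/rkerP; split; first by rewrite groupM ?groupV.
by rewrite repr_mxM ?groupV // E repr_mxVr.
Qed.

Lemma nonabelian_nonscalar L : L \subset G -> ~~ abelian L ->
  exists2 x, x \in L & forall a, rG x <> a%:M.
Proof.
move=> sLG; apply: contraNP => nsc; apply/centsP => x Lx y Ly.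
have [Gx Gy] := (fintype.subsetP sLG x Lx, fintype.subsetP sLG y Ly).
apply: faithful_inj; rewrite ?groupM // !repr_mxM //.
have [a ->] : exists a, rG x = a%:M.
  by apply: contrapT => nx; apply: nsc; exists x => // a xa; apply: nx; exists a.
by rewrite scalar_mxC.
Qed.

Lemma Ls_sub_K L : L \in Ls -> L \subset K.
Proof. by move=> LL; rewrite sub_gen // (finset.bigcup_max L). Qed.

Lemma commutes_K A : (forall L, L \in Ls -> commutes rG A L) -> commutes rG A K.
Proof.
move=> cA x Kx.
have sK : K \subset rcent rG A.
  rewrite gen_subG; apply/finset.bigcupsP => L LL; apply/fintype.subsetP => y Ly.
  by rewrite inE (fintype.subsetP (Ls_sub LL)) //= (cA L).
by have := fintype.subsetP sK x Kx; rewrite inE => /andP[_ /eqP ->].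
Qed.

Lemma K_normal : (K <| G)%g.
Proof.
apply/andP; split; first by rewrite gen_subG; apply/finset.bigcupsP.
apply: norms_gen; apply/fintype.subsetP => g Gg; rewrite inE.
apply/fintype.subsetP => _ /imsetP[y /finset.bigcupP[L LL Ly] ->].
by apply/finset.bigcupP; exists (L :^ g)%G; rewrite ?Ls_conj // memJ_conjg.
Qed.

Lemma K_sub : K \subset G.
Proof. by case/andP: K_normal. Qed.

Lemma K_norm_Ls L : L \in Ls -> (K \subset 'N(L))%g.
Proof.
move=> LL; rewrite gen_subG; apply/finset.bigcupsP => L' LL'.
have [<-|nL] := eqVneq L L'; first exact: normG.
by apply: fintype.subset_trans (Ls_com LL LL' nL) (cent_sub _).
Qed.

Lemma K_scalar L : L \in Ls -> scalar_commutant rG K.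
Proof.
move=> LL; apply: (normal_scalar_commutant d_gt4 fp std K_normal).
have [x Lx nx] := nonabelian_nonscalar (Ls_sub LL) (Ls_nab LL).
by exists x => //; apply: fintype.subsetP (Ls_sub_K LL) x Lx.
Qed.

Lemma Ls_commutes L L' x : L \in Ls -> L' \in Ls -> L != L' -> x \in L ->
  commutes rG (rG x) L'.
Proof.
move=> LL LL' nL Lx y L'y.
have [Gx Gy] := (fintype.subsetP (Ls_sub LL) x Lx, fintype.subsetP (Ls_sub LL') y L'y).
rewrite -!repr_mxM //; congr (rG _).
by apply: (centsP (Ls_com LL LL' nL) y L'y x Lx).
Qed.

(** The average commutes with [L] by construction and with the other members because [M] and [L] do,
    hence with the irreducible group [K]. *)
Lemma avg_other L M : L \in Ls ->
  (forall L', L' \in Ls -> L' != L -> commutes rG M L') ->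
  avg rG L M = (ntr M)%:M.
Proof.
move=> LL cM; have [|a E] := K_scalar LL (A := avg rG L M).
  apply: commutes_K => L' LL'; have [->|nL] := eqVneq L' L.
    exact/avg_commutes/Ls_sub.
  apply: avg_commutes_other; [exact: Ls_sub| |exact: cM].
  by move=> x Lx; apply: (Ls_commutes LL) => //; rewrite eq_sym.
by rewrite [LHS](scalar_ntr d_gt0 E) /ntr mxtrace_avg // Ls_sub.
Qed.

(** The traceless part of x: for x in a member of [Ls], the average over that member kills it and
    the averages over the others fix it. *)
Definition tless x : 'M[F]_d := rG x - (ntr (rG x))%:M.

Lemma tless_commutes L L' x : L \in Ls -> L' \in Ls -> L != L' -> x \in L ->
  commutes rG (tless x) L'.
Proof.
move=> LL LL' nL Lx y L'y; rewrite /tless mulmxBr mulmxBl.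
by rewrite (Ls_commutes LL LL' nL Lx) // scalar_mxC.
Qed.

Lemma avg_tless L x : L \in Ls -> x \in L -> avg rG L (tless x) = 0.
Proof.
move=> LL Lx; rewrite /tless avgB avg_other // => [|L' LL' nL].
  by rewrite avg_id ?subrr ?Ls_sub //; apply: commutes_scalar.
by apply: (Ls_commutes LL) => //; rewrite eq_sym.
Qed.

Lemma tless_conj L x n : L \in Ls -> x \in L -> n \in K ->
  exists2 y, y \in L & tless x *m rG n = rG n *m tless y.
Proof.
move=> LL Lx Kn; exists (x ^ n)%g; first by rewrite memJ_norm // (fintype.subsetP (K_norm_Ls LL)).
have Gn := fintype.subsetP K_sub n Kn; have Gx := fintype.subsetP (Ls_sub LL) x Lx.
have xn : rG n *m rG (x ^ n)%g = rG x *m rG n.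
  by rewrite -!repr_mxM ?groupJ // -conjgC.
rewrite /tless mulmxBr mulmxBl xn -scalar_mxC; congr (_ - _ *m _%:M).
rewrite /ntr; congr (_ / _); rewrite conjgE !repr_mxM ?groupM ?groupV //.
by rewrite mxtrace_mulC -mulmxA repr_mxVr // mulmx1.
Qed.

Lemma tless_nz L : L \in Ls -> exists2 x, x \in L & tless x != 0.
Proof.
move=> LL; have [x Lx nx] := nonabelian_nonscalar (Ls_sub LL) (Ls_nab LL).
by exists x => //; rewrite subr_eq0; apply/eqP/nx.
Qed.

(** Members of [K] can be moved across a traceless part at the price of a conjugation. If all
    products vanished, [scalar_commutant_prime] would therefore make some nonzero traceless part
    vanish. *)
Lemma tless2_nz L1 L2 : L1 \in Ls -> L2 \in Ls ->
  exists y z, [/\ y \in L1, z \in L2 & tless y *m tless z != 0].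
Proof.
move=> LL1 LL2; apply: contrapT => no.
have all0 y z : y \in L1 -> z \in L2 -> tless y *m tless z = 0.
  by move=> Ly Lz; apply: contrapT => /eqP nz; apply: no; exists y, z.
have [y Ly ny] := tless_nz LL1; have [z Lz nz] := tless_nz LL2.
case: (@scalar_commutant_prime _ _ _ _ rG K (tless y) (tless z) d_gt0 K_sub (K_scalar LL1)).
- move=> n Kn; have [y' Ly' ->] := tless_conj LL1 Ly Kn.
  by rewrite -mulmxA all0 // mulmx0.
- by apply/eqP.
- by apply/eqP.
Qed.

Lemma tless3_nz L1 L2 L3 : L1 \in Ls -> L2 \in Ls -> L3 \in Ls ->
  exists y z w, [/\ y \in L1, z \in L2, w \in L3 &
    tless y *m tless z *m tless w != 0].
Proof.
move=> LL1 LL2 LL3; apply: contrapT => no.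
have all0 y z w : y \in L1 -> z \in L2 -> w \in L3 ->
    tless y *m tless z *m tless w = 0.
  by move=> Ly Lz Lw; apply: contrapT => /eqP nz; apply: no; exists y, z, w.
have [y [z [Ly Lz nyz]]] := tless2_nz LL1 LL2; have [w Lw nw] := tless_nz LL3.
case: (@scalar_commutant_prime _ _ _ _ rG K (tless y *m tless z) (tless w)
  d_gt0 K_sub (K_scalar LL1)).
- move=> n Kn; have [z' Lz' Ez] := tless_conj LL2 Lz Kn.
  have [y' Ly' Ey] := tless_conj LL1 Ly Kn.
  rewrite -(mulmxA (tless y)) Ez (mulmxA (tless y)) Ey -!mulmxA.
  by rewrite (mulmxA (tless y')) all0 // mulmx0.
- by apply/eqP.
- by apply/eqP.
Qed.

Lemma sum_avg_eigen (Ks : {set {group gT}}) M : Ks \subset Ls ->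
  (forall L, L \in Ks -> avg rG L M = 0) ->
  (forall L, L \in Ls -> L \notin Ks -> avg rG L M = M) ->
  \sum_(L in Ls) avg rG L M = (#|Ls|%:R - #|Ks|%:R) *: M.
Proof.
move=> sKL K0 K1; rewrite (bigID (fun L => L \in Ks)) /= big1 ?add0r; last first.
  by move=> L /andP[_ /K0].
rewrite (eq_bigr (fun _ => M)) => [|L /andP[? ?]]; last exact: K1.
rewrite sumr_const -scaler_nat; congr (_ *: _).
rewrite -natrB ?subset_leq_card //; congr _%:R.
rewrite -cardsDS //; apply: eq_card => L; rewrite !inE andbC; by [].
Qed.

Lemma tr_sum_avg M : \tr (\sum_(L in Ls) avg rG L M) = #|Ls|%:R * \tr M.
Proof.
rewrite raddf_sum /= (eq_bigr (fun _ => \tr M)) => [|L LL].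
  by rewrite sumr_const mulr_natl.
by rewrite mxtrace_avg // Ls_sub.
Qed.

Lemma sum_avg_std : exists a b c, (forall M,
    \sum_(L in Ls) avg rG L M = a *: M + (b * \tr M)%:M + c *: star M) /\
  (c = 0 \/ forall g, g \in G -> star (rG g) = rG g^-1%g).
Proof.
have [a0 [b0 [c0 [E c00]]]] := std (conj_sum_endT2 Ls_sub Ls_conj).
exists (q%:R^-1 * a0), (q%:R^-1 * b0), (q%:R^-1 * c0); split=> [M|].
  have := sandwich_std M E; rewrite sandwich_conj_sum.
  rewrite (eq_bigr (fun L => q%:R *: avg rG L M)) => [|L LL]; last first.
    by rewrite avg_sum Ls_card.
  rewrite -scaler_sumr.
  have [Ls0|[L LL]] := set_0Vmem Ls.
    rewrite Ls0 big_set0 scaler0 => /esym E0.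
    rewrite -[LHS](scaler0 _ q%:R^-1) -E0 !scalerDr !scalerA.
    by rewrite scale_scalar_mx mulrA.
  have q0 : q%:R != 0 :> F by rewrite -(Ls_card LL) card_neq0.
  move/(congr1 (fun Y => q%:R^-1 *: Y)); rewrite scalerA mulVf // scale1r => ->.
  by rewrite !scalerDr !scalerA scale_scalar_mx mulrA.
case: c00 => [->|iso]; [by left; rewrite mulr0|right=> g Gg].
by apply: (adj_repr fp Gg); apply: iso; exists g.
Qed.

Local Notation t x := (ntr (rG x)).

(** Meant for products of traceless parts from distinct members [Ks]. Averaging preserves the trace,
    which is incompatible with the eigenvalue |Ls| - |Ks| unless tr M = 0. The squares agree because
    the adjoint is an involution. *)
Lemma tless_eigen a b c (Ks : {set {group gT}}) M :
    (forall M, \sum_(L in Ls) avg rG L M = a *: M + (b * \tr M)%:M + c *: star M) ->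
    Ks \subset Ls -> (0 < #|Ks|)%N -> M != 0 ->
    (forall L, L \in Ks -> avg rG L M = 0) ->
    (forall L, L \in Ls -> L \notin Ks -> avg rG L M = M) ->
  (#|Ls|%:R - a - #|Ks|%:R) *: M = c *: star M /\
  (#|Ls|%:R - a - #|Ks|%:R) ^+ 2 = c ^+ 2.
Proof.
move=> P sKL K0 M0 kill fix_; have E := sum_avg_eigen sKL kill fix_.
have trM : \tr M = 0.
  have := tr_sum_avg M; rewrite E mxtraceZ => /eqP.
  rewrite -subr_eq0 -mulrBl addrAC subrr add0r mulf_eq0 oppr_eq0 pnatr_eq0.
  by rewrite -leqn0 leqNgt K0 => /eqP.
have E1 : (#|Ls|%:R - a - #|Ks|%:R) *: M = c *: star M.
  rewrite addrAC scalerBl -E P trM mulr0 raddf0 addr0.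
  by rewrite addrAC subrr add0r.
split=> //; have := congr1 star E1; rewrite !adjZ (adjK fp) => E2.
have : ((#|Ls|%:R - a - #|Ks|%:R) ^+ 2 - c ^+ 2) *: M = 0.
  by rewrite scalerBl !expr2 -!scalerA E1 -E2 !scalerA [c * _]mulrC subrr.
by move/eqP; rewrite scaler_eq0 (negPf M0) orbF subr_eq0 => /eqP.
Qed.

(** As in the quaternions, x + x^-1 is twice the scalar [t x]. For a nonscalar w the sum of y w y
    over y in L is computed twice: from (y w)^2 w^-1, and by writing the last y as 2 t(y) - y^-1. *)
Lemma skew_kappa L : L \in Ls ->
    (forall x, x \in L -> rG x^-1%g = (2%:R * t x)%:M - rG x) ->
  4%:R * \sum_(y in L) t y * t y = #|L|%:R.
Proof.
move=> LL skew; set kap := \sum_(y in L) _.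
have sLG := Ls_sub LL; have GL x := fintype.subsetP sLG x.
pose Q := \sum_(y in L) t y *: rG y.
have tJ y z : y \in G -> z \in G -> t (y ^ z)%g = t y.
  move=> Gy Gz; rewrite /ntr conjgE !repr_mxM ?groupM ?groupV //.
  by rewrite mxtrace_mulC -mulmxA repr_mxVr // mulmx1.
have QE : Q = kap%:M.
  have [|a E] := K_scalar LL (A := Q).
    apply: commutes_K => L' LL'; have [->|nL] := eqVneq L' L.
      move=> z Lz; rewrite /Q mulmx_sumr mulmx_suml.
      rewrite [RHS](reindex_inj (conjg_inj z^-1%g)) /=; apply: eq_big => y.
        by rewrite groupJr ?groupV.
      move=> Ly; rewrite tJ ?groupV ?GL // -scalemxAr -scalemxAl -!repr_mxM ?groupJ ?groupV ?GL //.
      by congr (_ *: rG _); rewrite conjgE invgK !mulgA mulgKV.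
    move=> z Lz; rewrite /Q mulmx_sumr mulmx_suml; apply: eq_bigr => y Ly.
    by rewrite -scalemxAr -scalemxAl (Ls_commutes LL LL') // eq_sym.
  rewrite [LHS](scalar_ntr d_gt0 E) /Q /ntr raddf_sum /= mulr_suml.
  by congr _%:M; apply: eq_bigr => y Ly; rewrite mxtraceZ mulrA.
have sq y : y \in L -> rG y *m rG y = (2%:R * t y) *: rG y - 1%:M.
  move=> Ly; have := repr_mxVl rG (GL y Ly); rewrite skew // mulmxBl mul_scalar_mx.
  by move=> <-; rewrite opprB addrC subrK.
pose S := \sum_(y in L) rG y *m rG y.
have SE : S = (2%:R * kap - #|L|%:R)%:M.
  rewrite /S (eq_bigr _ sq) sumrB sumr_const.
  under eq_bigr do rewrite -scalerA.
  rewrite -scaler_sumr -/Q QE scale_scalar_mx raddfB /=; congr (_ - _).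
  by rewrite -scaler_nat scalemx1.
have [w Lw nsw] := nonabelian_nonscalar sLG (Ls_nab LL).
pose T := \sum_(y in L) rG y *m rG w *m rG y.
have T1 : T = (2%:R * kap - #|L|%:R) *: ((2%:R * t w)%:M - rG w).
  rewrite -skew // -mul_scalar_mx -SE /S mulmx_suml.
  rewrite [RHS](reindex_inj (mulIg w)) /=; apply: eq_big => y.
    by rewrite groupMr.
  move=> Ly; rewrite !repr_mxM ?GL // -!mulmxA.
  by rewrite repr_mxVr ?GL // mulmx1.
have T2 : T = (2%:R * kap) *: rG w - (#|L|%:R * t w)%:M.
  have -> : (#|L|%:R * t w)%:M = \sum_(y in L) rG y *m rG w *m rG y^-1%g.
    rewrite avg_sum avg_other // => [|L' LL' nL]; first by rewrite scale_scalar_mx.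
    by apply: (Ls_commutes LL) => //; rewrite eq_sym.
  rewrite -scalerA -(mul_scalar_mx kap) -QE /Q mulmx_suml scaler_sumr -sumrB.
  apply: eq_bigr => y Ly; rewrite skew // mulmxBr mul_mx_scalar opprB addrCA.
  by rewrite -scalemxAl scalerA subrr addr0.
have E : (4%:R * kap - #|L|%:R) *: rG w = ((4%:R * kap - #|L|%:R) * t w)%:M.
  move: T1; rewrite T2; move: (rG w) (t w) => W tw E.
  apply/matrixP => i j; have := congr1 (fun M : 'M_d => M i j) E; rewrite !mxE.
  move: (W i j) => u; case: (i == j); rewrite ?mulr1n ?mulr0n => /eqP;
    rewrite -subr_eq0 => /eqP E'; apply/eqP; rewrite -subr_eq0; apply/eqP;
    by rewrite -[RHS]E'; ring.
apply/eqP; rewrite -subr_eq0; apply: contrapT => /negP nz.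
case: (nsw (t w)); apply: (scalerI nz); rewrite E scale_scalar_mx //.
Qed.

(** Let k be the number of members. Products of one and of two traceless parts give (k - a - 1)^2 =
    (k - a - 2)^2 = c^2, so k - a = 3/2 and c is 1/2 or -1/2. A third member would require 9/4 =
    1/4. With two members, c = 1/2 makes them abelian and c = -1/2 leads to d = 4. *)
Lemma Ls_le1 : (#|Ls| <= 1)%N.
Proof.
rewrite leqNgt; apply/negP => /card_gt1P[L1 [L2 [LL1 LL2 n12]]].
have n21 : L2 != L1 by rewrite eq_sym.
have [a [b [c [P cc]]]] := sum_avg_std; set k := #|Ls|%:R : F.
have ev1 L x : L \in Ls -> x \in L -> tless x != 0 ->
    (k - a - 1) *: tless x = c *: star (tless x) /\ (k - a - 1) ^+ 2 = c ^+ 2.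
  move=> LL Lx nx; have := @tless_eigen a b c [set L] (tless x) P.
  rewrite cards1; apply; rewrite ?finset.sub1set //.
    by move=> L' /set1P ->; apply: avg_tless.
  move=> L' LL'; rewrite inE => nL; apply: avg_id (Ls_sub LL') _.
  by apply: (tless_commutes LL) => //; rewrite eq_sym.
have [p1 Lp1 np1] := tless_nz LL1; have [_ sq1] := ev1 _ _ LL1 Lp1 np1.
have sq2 : (k - a - 2%:R) ^+ 2 = c ^+ 2.
  have [y [z [Ly Lz nyz]]] := tless2_nz LL1 LL2.
  have := @tless_eigen a b c [set L1; L2] (tless y *m tless z) P.
  rewrite cards2 n12 => H; apply H => //.
  - by apply/fintype.subsetP => L /set2P[]->.
  - move=> L /set2P[]->.
      by rewrite avgMr ?(avg_tless LL1) ?mul0mx ?Ls_sub //; apply: tless_commutes LL2 _ _ _.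
    by rewrite avgMl ?(avg_tless LL2) ?mulmx0 ?Ls_sub //; apply: tless_commutes LL1 _ _ _.
  move=> L LL; rewrite !inE negb_or => /andP[nL1 nL2]; apply: avg_id (Ls_sub LL) _.
  move=> x Lx; rewrite mulmxA (tless_commutes LL1 LL _ Ly) 1?eq_sym //.
  by rewrite -!mulmxA (tless_commutes LL2 LL _ Lz) 1?eq_sym.
have l1 : k - a - 1 = 2%:R^-1.
  have n2 : 2%:R != 0 :> F by rewrite pnatr_eq0.
  have /eqP := sq1; rewrite -sq2 -subr_eq0 => /eqP E.
  apply: (mulfI n2); rewrite mulfV //; apply/eqP; rewrite -subr_eq0; apply/eqP.
  by rewrite -[RHS]E; ring.
have Ls12 L : L \in Ls -> L = L1 \/ L = L2.
  move=> LL; have [->|nL1] := eqVneq L L1; [by left|right].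
  have [//|nL2] := eqVneq L L2.
  have [y [z [w [Ly Lz Lw nz]]]] := tless3_nz LL1 LL2 LL.
  exfalso; have := @tless_eigen a b c [set L1; L2; L] (tless y *m tless z *m tless w) P.
  have -> : #|[set L1; L2; L]%SET| = 3%N.
    by rewrite finset.setUC cardsU1 !inE (negPf nL1) (negPf nL2) cards2 n12.
  case=> //.
  - by apply/fintype.subsetP => L'; rewrite !inE => /orP[/orP[]|] /eqP ->.
  - move=> L'; rewrite !inE => /orP[/orP[]|] /eqP ->.
    + rewrite -mulmxA avgMr ?(avg_tless LL1) ?mul0mx ?Ls_sub // => x Lx.
      rewrite mulmxA (tless_commutes LL2 LL1 _ Lz) // -!mulmxA.
      by rewrite (tless_commutes LL LL1 _ Lw).
    + rewrite avgMr ?Ls_sub //; last by apply: (tless_commutes LL).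
      rewrite avgMl ?Ls_sub // ?(avg_tless LL2) ?mulmx0 ?mul0mx //.
      by apply: (tless_commutes LL1).
    + rewrite avgMl ?(avg_tless LL) ?mulmx0 ?Ls_sub // => x Lx.
      rewrite mulmxA (tless_commutes LL1 LL _ Ly) 1?eq_sym // -!mulmxA.
      by rewrite (tless_commutes LL2 LL _ Lz) 1?eq_sym.
  - move=> L' LL'; rewrite !inE !negb_or => /andP[/andP[m1 m2] m3].
    apply: avg_id (Ls_sub LL') _ => x Lx.
    rewrite !mulmxA (tless_commutes LL1 LL' _ Ly) 1?eq_sym //.
    rewrite -![_ *m rG x *m _]mulmxA (tless_commutes LL2 LL' _ Lz) 1?eq_sym //.
    rewrite !mulmxA -![_ *m rG x *m tless w]mulmxA.
    by rewrite (tless_commutes LL LL' _ Lw) 1?eq_sym // !mulmxA.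
  move=> _; rewrite -sq1 -/k => /eqP; rewrite -subr_eq0.
  have -> : (k - a - 3%:R) ^+ 2 - (k - a - 1) ^+ 2 = 4%:R - 4%:R * (k - a - 1) by ring.
  rewrite l1 (_ : 4%:R - 4%:R * 2%:R^-1 = 2%:R :> F) ?pnatr_eq0 //.
  by field.
have c0 : c != 0.
  apply/eqP => c0; move: sq1; rewrite l1 c0 expr0n /= => /eqP.
  by rewrite expf_eq0 /= invr_eq0 pnatr_eq0.
(* A nonzero c excludes the alternative without an invariant form, so the adjoint is inversion on
   G. *)
have invE g : g \in G -> star (rG g) = rG g^-1%g.
  by case: cc => [cz|H]; [move: c0; rewrite cz eqxx|apply: H].
have star0 : star 0 = 0 by rewrite /adj trmx0 mulmx0 mul0mx.
have starE L x : L \in Ls -> x \in L ->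
    2%:R^-1 *: tless x = c *: (rG x^-1%g - (t x)%:M).
  move=> LL Lx; rewrite -invE ?(fintype.subsetP (Ls_sub LL)) // -(adj_scalar fp (t x)).
  rewrite -(adjB B C); have [nx|nx] := eqVneq (tless x) 0.
    by rewrite -/(tless x) nx star0 !scaler0.
  by have [<- _] := ev1 _ _ LL Lx nx; rewrite l1.
have : (c - 2%:R^-1) * (c + 2%:R^-1) = 0.
  by rewrite -subr_sqr -sq1 l1 subrr.
move/eqP; rewrite mulf_eq0 subr_eq0 addr_eq0 => /orP[]/eqP cE.
  have n2 : 2%:R^-1 != 0 :> F by rewrite invr_eq0 pnatr_eq0.
  (* The case c = 1/2: every element is its own inverse, which makes the group abelian. *)
  have inv x : x \in L1 -> (x^-1 = x)%g.
    move=> Lx; have Gx := fintype.subsetP (Ls_sub LL1) x Lx.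
    apply: faithful_inj; rewrite ?groupV //.
    by have := starE L1 x LL1 Lx; rewrite cE => /(scalerI n2)/addIr.
  case/negP: (Ls_nab LL1); apply/centsP => x Lx y Ly.
  by rewrite /commute -[LHS]inv ?groupM // invMg !inv.
have skew L x : L \in Ls -> x \in L -> rG x^-1%g = (2%:R * t x)%:M - rG x.
  move=> LL Lx; have := starE L x LL Lx; rewrite cE.
  have n2 : 2%:R^-1 != 0 :> F by rewrite invr_eq0 pnatr_eq0.
  rewrite scaleNr -scalerN => /(scalerI n2); rewrite /tless.
  move: (rG x) (t x) (rG x^-1%g) => X tx Y E; apply/matrixP => i j.
  have := congr1 (fun M : 'M_d => M i j) E; rewrite !mxE.
  move: (X i j) (Y i j) => u v; case: (i == j); rewrite ?mulr1n ?mulr0n => /eqP;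
    rewrite -subr_eq0 => /eqP E'; apply/eqP; rewrite -subr_eq0; apply/eqP;
    by rewrite -[RHS]E'; ring.
have k1 := skew_kappa LL1 (skew L1 ^~ LL1); have k2 := skew_kappa LL2 (skew L2 ^~ LL2).
have tV L x : L \in Ls -> x \in L -> t x^-1%g = t x.
  move=> LL Lx; rewrite /ntr (skew L x LL Lx) raddfB /= mxtrace_scalar.
  rewrite -mulr_natr /ntr; by field.
have trM x y : x \in L1 -> y \in L2 -> \tr (rG x *m rG y) = t x * \tr (rG y).
  move=> Lx Ly; rewrite -(mxtrace_avg rG _ (Ls_sub LL1)) avgMr ?Ls_sub //; last first.
    by apply: (Ls_commutes LL2).
  rewrite avg_other // => [|L' LL' nL]; first by rewrite mul_scalar_mx mxtraceZ.
  by apply: (Ls_commutes LL1) => //; rewrite eq_sym.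
pose PP (p : gT * gT) := (p.1 \in L1) && (p.2 \in L2).
(* With only two members, averaging over both lands in the commutant of [K]; this is Schur
   orthogonality for the products x y. *)
have sch M : \sum_(p | PP p) (rG p.1 *m rG p.2) *m M *m (rG p.2^-1%g *m rG p.1^-1%g) =
    (#|L1|%:R * #|L2|%:R / d%:R * \tr M)%:M.
  rewrite -(pair_big (mem L1) (mem L2) (fun x y =>
    (rG x *m rG y) *m M *m (rG y^-1%g *m rG x^-1%g))) /=.
  transitivity (\sum_(x in L1) rG x *m (#|L2|%:R *: avg rG L2 M) *m rG x^-1%g).
    apply: eq_bigr => x Lx; rewrite -avg_sum mulmx_sumr mulmx_suml.
    by apply: eq_bigr => y Ly; rewrite !mulmxA.
  rewrite avg_sum avgZ; have [|s E] := K_scalar LL1 (A := avg rG L1 (avg rG L2 M)).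
    apply: commutes_K => L /Ls12[]->; first exact/avg_commutes/Ls_sub.
    apply: avg_commutes_other; [exact: Ls_sub| |exact/avg_commutes/Ls_sub].
    by move=> x Lx; apply: (Ls_commutes LL1).
  rewrite [avg rG L1 _](scalar_ntr d_gt0 E) /ntr !mxtrace_avg ?Ls_sub //.
  by rewrite !scale_scalar_mx; congr _%:M; ring.
have := schur_trace sch; rewrite divfK //.
rewrite -(pair_big (mem L1) (mem L2) (fun x y =>
    \tr (rG x *m rG y) * \tr (rG y^-1%g *m rG x^-1%g))) /=.
rewrite (eq_bigr (fun x => (t x * t x) * (d%:R ^+ 2 * \sum_(y in L2) t y * t y))).
  rewrite -mulr_suml => E.
  (* The squares of [t] have mean 1/4 on each member and tr(x y) = d t(x) t(y), so orthogonality
     reads d^2 / 16 = 1. *)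
  have : (d%:R ^+ 2 - 16%:R) * (#|L1|%:R * #|L2|%:R) = 0 :> F.
    by rewrite mulrBl -{2}E -k1 -k2; ring.
  move/eqP; rewrite !mulf_eq0 !(negPf (card_neq0 F _)) !orbF subr_eq0 -natrX eqr_nat.
  by move=> /eqP d2; have := leq_mul d_gt4 d_gt4; rewrite !mulnn d2.
move=> x Lx; rewrite !mulr_sumr; apply: eq_bigr => y Ly.
rewrite trM // [X in _ * X]mxtrace_mulC trM ?groupV // (tV L1) //.
have trE z : \tr (rG z) = t z * d%:R by rewrite /ntr divfK.
by rewrite !trE (tV L2) //; ring.
Qed.

End CommutingConjugates.

(** * Extraspecial factors of p-groups *)

Section ExtraspecialFactor.

Local Open Scope group_scope.

Variables (gT : finGroupType) (p : nat) (Q A : {group gT}).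
Hypotheses (p_pr : prime p) (pQ : p.-group Q) (nabQ : ~~ abelian Q).
Hypotheses (sAZ : A \subset 'Z(Q)) (oA : #|A| = p).
Hypotheses (QpA : forall x, x \in Q -> x ^+ p \in A) (sQ'A : Q^`(1) \subset A).

(* A subgroup E minimal for E * 'Z(Q) = Q has 'Z(E) inside its Frattini
   subgroup, which is contained in A. *)
Lemma extraspecial_factor : exists E : {group gT},
  [/\ E \subset Q, extraspecial E & E * 'Z(Q) = Q].
Proof.
have [E minE sEQ] : {E : {group gT} |
    [min E of H | (H \subset Q) && (H * 'Z(Q) == Q)] & E \subset Q}.
  by apply: mingroup_exists; rewrite subxx /= mulGSid ?center_sub.
have /mingroupP[/andP[_ /eqP EZ] minEP] := minE.
have pE := pgroupS sEQ pQ.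
have sZEZQ : 'Z(E) \subset 'Z(Q).
  rewrite finset.subsetI (fintype.subset_trans (center_sub E) sEQ) /= -EZ centM finset.subsetI.
  rewrite finset.subsetIr /= (fintype.subset_trans (center_sub E)) // (fintype.subset_trans sEQ) //.
  by rewrite centsC finset.subsetIr.
have sZPhi : 'Z(E) \subset 'Phi(E).
  apply/finset.bigcapsP => M /predU1P[->|maxM]; first exact: center_sub.
  apply: contraT => nsZM.
  have nME := p_maximal_normal pE maxM; have sME := normal_sub nME.
  (* Otherwise M would already be a complement to the centre of Q in the sense required of E,
     against minimality. *)
  have ME : M * 'Z(E) = E := mulg_normal_maximal nME maxM (center_sub E) nsZM.
  have EM : M :=: E.
    apply: minEP => //; rewrite (fintype.subset_trans sME sEQ) /=.
    by apply/eqP; rewrite -[RHS]EZ -ME -mulgA (mulSGid sZEZQ).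
  by have := maxgroupp maxM; rewrite EM fintype.properxx.
have sE'A : E^`(1) \subset A := fintype.subset_trans (dergS 1 sEQ) sQ'A.
have sPhiA : 'Phi(E) \subset A.
  rewrite (Phi_joing pE) join_subG sE'A (MhoE 1 pE) gen_subG.
  apply/fintype.subsetP => _ /imsetP[x Ex ->]; rewrite expn1.
  exact/QpA/(fintype.subsetP sEQ).
have nabE : ~~ abelian E.
  apply: contra nabQ => abE; rewrite -EZ abelianM abE center_abelian /=.
  by rewrite (fintype.subset_trans (finset.subsetIr _ _)) // centS.
have E'A : E^`(1) :=: A.
  apply/eqP; rewrite eqEcard sE'A oA /=.
  have : E^`(1) != 1 by apply: contra nabE => /eqP/derG1P.
  rewrite trivg_card1 => n1; have := cardSg sE'A; rewrite oA.
  by case/(primeP p_pr).2/orP => /eqP E1; rewrite E1 // eqxx in n1 *.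
have sAE : A \subset E by rewrite -E'A der_sub.
have sAZE : A \subset 'Z(E).
  rewrite finset.subsetI sAE (fintype.subset_trans sAZ) // (fintype.subset_trans (finset.subsetIr _ _)) //.
  exact: centS.
have ZEA : 'Z(E) = A by apply/eqP; rewrite finset.eqEsubset sAZE (fintype.subset_trans sZPhi sPhiA).
have PhiA : 'Phi(E) = A by apply/eqP; rewrite finset.eqEsubset sPhiA (fintype.subset_trans sAZE sZPhi).
exists E; split=> //; split; last by rewrite ZEA oA.
by split; rewrite ?ZEA ?PhiA.
Qed.

End ExtraspecialFactor.

(** * Groups of symplectic type and their degree *)

Section SymplecticType.

Variables (F : numFieldType) (d : nat) (gT : finGroupType) (Q : {group gT}).
Variable rQ : mx_representation F Q d.
Variable p : nat.
Hypotheses (d_gt0 : (0 < d)%N) (p_pr : prime p) (fQ : mx_faithful rQ).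
Hypotheses (nabQ : ~~ abelian Q) (scQ : scalar_commutant rQ Q).
Hypothesis powQ : forall x, x \in Q ->
  exists2 s, rQ (x ^+ p)%g = s%:M & s ^+ p = 1.
Hypothesis comQ : forall x y, x \in Q -> y \in Q ->
  exists2 s, rQ [~ x, y]%g = s%:M & s ^+ p = 1.

Let inj x y := @faithful_inj F d gT Q rQ fQ x y.

Lemma scalar_exp x (s : F) m : x \in Q -> rQ x = s%:M -> rQ (x ^+ m)%g = (s ^+ m)%:M.
Proof.
move=> Qx xs; elim: m => [|m IH]; first by rewrite expg0 repr_mx1.
by rewrite expgS repr_mxM ?groupX // xs IH -scalar_mxM exprS.
Qed.

Lemma scalar_central x s : x \in Q -> rQ x = s%:M -> (x \in 'Z(Q))%g.
Proof.
move=> Qx xs; apply/centerP; split=> // y Qy; apply: inj; rewrite ?groupM //.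
by rewrite !repr_mxM // xs scalar_mxC.
Qed.

Lemma central_scalar x : (x \in 'Z(Q))%g -> exists s, rQ x = s%:M.
Proof.
case/centerP => Qx cx; apply: scQ => y Qy; rewrite -!repr_mxM //.
by congr (rQ _); rewrite cx.
Qed.

Lemma scalar_inj x y s : x \in Q -> y \in Q -> rQ x = s%:M -> rQ y = s%:M -> x = y.
Proof. by move=> Qx Qy xs ys; apply: inj; rewrite // xs ys. Qed.

(** A nontrivial commutator acts as a primitive p-th root of unity and generates the subgroup A
    needed by [extraspecial_factor]. A noncentral element of E is conjugate to a multiple of itself
    by a scalar other than 1, so its trace is 0; Schur orthogonality becomes d^2 |Z(E)| = |E| =
    p^(2n+1). *)
Lemma symplectic_type_factor : exists2 E : {group gT},
  [/\ E \subset Q, (p.-group E)%g, extraspecial E & (E * 'Z(Q) = Q)%g]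
  & exists a, d = (p ^ a)%N.
Proof.
have [x [y [Qx Qy nxy]]] : exists x y, [/\ x \in Q, y \in Q & [~ x, y]%g != 1%g].
  apply: contrapT => no; case/negP: nabQ; apply/centsP => x Qx y Qy.
  by apply/commgP; apply: contrapT => /negP nxy; apply: no; exists x, y.
set z := [~ x, y]%g in nxy; have Qz : z \in Q by rewrite groupR.
have [w zw wp] := comQ Qx Qy; rewrite -/z in zw.
have w1 : w != 1.
  by apply: contra nxy => /eqP we; apply/eqP/(inj Qz (group1 Q)); rewrite zw we repr_mx1.
have prw : p.-primitive_root w.
  have /prim_order_exists[|m prm] : w ^+ p = 1 by []; first exact: prime_gt0.
  case/(primeP p_pr).2/orP => /eqP E; last by rewrite -E.
  by move: prm w1; rewrite E => /prim_expr_order; rewrite expr1 => ->; rewrite eqxx.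
have zA t s : t \in Q -> rQ t = s%:M -> s ^+ p = 1 -> t \in <[z]>%g.
  move=> Qt ts sp; have [i si] := prim_rootP prw sp.
  have -> : t = (z ^+ i)%g.
    by apply: (scalar_inj Qt _ ts); rewrite ?groupX // (scalar_exp _ Qz zw) si.
  exact: mem_cycle.
have ozp : #[z]%g = p.
  have zp : (z ^+ p = 1)%g.
    by apply: inj; rewrite ?groupX // (scalar_exp _ Qz zw) wp repr_mx1.
  have : (#[z]%g %| p)%N by rewrite order_dvdn zp.
  case/(primeP p_pr).2/orP => /eqP //; rewrite -/#[z]%g => /eqP.
  by rewrite order_eq1 (negPf nxy).
have pQ : (p.-group Q)%g.
  rewrite -pnat_exponent; apply: (@pnat_dvd _ (p ^ 2)); last by rewrite pnatX pnat_id.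
  apply/exponentP => t Qt; have [s ts sp] := powQ Qt.
  by apply: inj; rewrite ?groupX // expnS expn1 expgM (scalar_exp _ _ ts) ?groupX // sp repr_mx1.
have [||||E [sEQ esE EZ]] := @extraspecial_factor gT p Q <[z]>%G p_pr pQ nabQ.
- by rewrite cycle_subG (scalar_central Qz zw).
- exact: ozp.
- by move=> t Qt; have [s ts sp] := powQ Qt; apply: zA ts sp; rewrite groupX.
- rewrite gen_subG; apply/fintype.subsetP => _ /imset2P[t u Qt Qu ->].
  by have [s ts sp] := comQ Qt Qu; apply: zA ts sp; rewrite groupR.
have pE := pgroupS sEQ pQ; exists E => //.
have ZEQ t : (t \in 'Z(E))%g -> exists s, rQ t = s%:M.
  move=> ZEt; apply: central_scalar; have /centerP[Et ct] := ZEt.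
  apply/centerP; split; first exact: fintype.subsetP Et.
  move=> u; rewrite -{1}EZ => /mulsgP[e v Ee /centerP[_ cv] ->].
  by rewrite /commute mulgA ct // -!mulgA cv // (fintype.subsetP sEQ).
have scE : scalar_commutant rQ E.
  move=> M cM; apply: scQ => u; rewrite -{1}EZ => /mulsgP[e' v Ee Zv ->].
  have Qv := fintype.subsetP (center_sub Q) v Zv.
  have [s vs] := central_scalar Zv; have Qe := fintype.subsetP sEQ e' Ee.
  by rewrite repr_mxM // vs mul_mx_scalar -scalemxAl -scalemxAr cM.
have chi0 t : t \in E -> (t \notin 'Z(E))%g -> \tr (rQ t) = 0.
  move=> Et nZt; have Qt := fintype.subsetP sEQ t Et.
  have [u Eu nu] : exists2 u, u \in E & [~ t, u]%g != 1%g.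
    apply: contrapT => no; case/negP: nZt; apply/centerP; split=> // u Eu.
    by apply/commgP; apply: contrapT => /negP nu; apply: no; exists u.
  have Qu := fintype.subsetP sEQ u Eu; have [s us _] := comQ Qt Qu.
  have s1 : s != 1.
    apply: contra nu => /eqP se; apply/eqP/(inj _ (group1 Q)); rewrite ?groupR //.
    by rewrite us se repr_mx1.
  have : \tr (rQ (t ^ u)%g) = \tr (rQ t).
    rewrite conjgE !repr_mxM ?groupM ?groupV //.
    by rewrite mxtrace_mulC -mulmxA repr_mxVr // mulmx1.
  rewrite conjg_mulR repr_mxM ?groupR // us mul_mx_scalar mxtraceZ => /eqP.
  by rewrite -subr_eq0 -{2}[\tr _]mul1r -mulrBl mulf_eq0 subr_eq0 (negPf s1) => /eqP.
have dZ : (d ^ 2 * #|'Z(E)%g| = #|E|)%N.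
  apply/eqP; rewrite -(eqr_nat F) -(scalar_commutant_chi d_gt0 sEQ scE).
  rewrite (bigID (fun t => t \in 'Z(E)%g)) /= [X in _ + X]big1 ?addr0; last first.
    by move=> t /andP[Et nZt]; rewrite chi0 // mul0r.
  rewrite (eq_bigl (fun t => t \in 'Z(E)%g)); last first.
    by move=> t /=; rewrite andb_idl // => /(fintype.subsetP (center_sub E)).
  rewrite (eq_bigr (fun _ => (d ^ 2)%:R)) => [|t Zt].
    by rewrite sumr_const natrM mulr_natr.
  have Et := fintype.subsetP (center_sub E) t Zt; have Qt := fintype.subsetP sEQ t Et.
  have [s ts] := ZEQ t Zt; have [s' ts'] := ZEQ _ (groupVr Zt).
  have : s * s' = 1.
    have := repr_mxVr rQ Qt; rewrite ts ts' -scalar_mxM => /matrixP.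
    by move/(_ (Ordinal d_gt0) (Ordinal d_gt0)); rewrite !mxE eqxx !mulr1n.
  rewrite ts ts' !mxtrace_scalar => ss.
  by rewrite -[s *+ d]mulr_natr -[s' *+ d]mulr_natr natrX mulrACA ss mul1r expr2.
have [n n0 oE] := card_extraspecial pE esE; exists n.
have oZ : #|'Z(E)%g| = p := card_center_extraspecial pE esE.
move: dZ; rewrite oE oZ (expnSr p) => /eqP; rewrite eqn_pmul2r ?prime_gt0 //.
by rewrite -muln2 expnM eqn_exp2r // => /eqP.
Qed.

Lemma repr_image_linear_group : is_linear_group (repr_image rQ).
Proof.
split; first by move=> _ [x Qx ->]; apply: repr_mx_unit.
- by exists 1%g; rewrite ?repr_mx1.
- by move=> _ _ [x Qx ->] [y Qy ->]; exists (x * y)%g; rewrite ?groupM ?repr_mxM.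
- by move=> _ [x Qx ->]; exists (x^-1)%g; rewrite ?groupV ?repr_mxV.
Qed.

Lemma repr_image_irreducible : irreducible_on (repr_image rQ).
Proof.
apply/irreducible_onE.
exact: (subg_mx_irr (scalar_commutant_irr (subxx_hint (mem Q)) d_gt0 scQ)).
Qed.

Lemma repr_image_symplectic : symplectic_type p (repr_image rQ).
Proof.
have [E [sEQ pE esE EZ] _] := symplectic_type_factor.
exists gT, E, (subg_repr rQ sEQ); split=> //.
- exact: subg_mx_faithful.
- by move=> _ [x Ex ->]; exists x => //; apply: fintype.subsetP Ex.
apply/seteqP; split=> g.
  case=> x; rewrite -{1}EZ => /mulsgP[u z Eu Zz ->] ->.
  have /centerP[Qz cz] := Zz; have Qu := fintype.subsetP sEQ u Eu.
  exists (rQ z), (rQ u); split; [|by exists u|].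
    split; first by exists z.
    by move=> _ [y Qy ->]; rewrite -!repr_mxM // cz.
  by rewrite -repr_mxM // cz.
case=> z [u [[[x Qx ->] _] [v Ev ->] ->]].
have Qv := fintype.subsetP sEQ v Ev.
by exists (x * v)%g; rewrite ?groupM ?repr_mxM.
Qed.

End SymplecticType.

Lemma prim_root_exists (F : numClosedFieldType) n :
  (0 < n)%N -> exists z : F, n.-primitive_root z.
Proof.
move=> n_gt0; pose p : {poly F} := 'X^n - 1.
have [r Dp] := closed_field_poly_normal p.
rewrite (monicP _) ?monicXnsubC // scale1r in Dp.
have rn1 : all n.-unity_root r by apply/allP=> z; rewrite -root_prod_XsubC -Dp.
have sz_r : (n < (size r).+1)%N.
  by rewrite -(size_prod_XsubC r id) -Dp size_XnsubC.
have [|z] := hasP (has_prim_root n_gt0 rn1 _ sz_r); last by exists z.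
by rewrite -separable_prod_XsubC -Dp separable_Xn_sub_1 // pnatr_eq0 -lt0n.
Qed.

(** * Adjoining roots of unity to obtain a p-group *)

Section ScalarExtension.

Variables (F : numClosedFieldType) (d : nat) (gT : finGroupType) (N : {group gT}).
Variables (rN : mx_representation F N d) (p : nat).
Hypotheses (d_gt0 : (0 < d)%N) (p_pr : prime p) (fN : mx_faithful rN).
Hypotheses (nabN : ~~ abelian N) (scN : scalar_commutant rN N).
Hypothesis powN : forall x, x \in N -> exists s, rN (x ^+ p)%g = s%:M.
Hypothesis comN : forall x y, x \in N -> y \in N ->
  exists2 s, rN [~ x, y]%g = s%:M & s ^+ p = 1.

Lemma comm_exp_p x y : x \in N -> y \in N -> ([~ x, y] ^+ p = 1)%g.
Proof.
move=> Nx Ny; have [s xs sp] := comN Nx Ny.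
apply: (faithful_inj fN); rewrite ?groupX ?groupR //.
by rewrite (scalar_exp p _ xs) ?groupR // sp repr_mx1.
Qed.

(** (x y)^p is x^p y^p times a power of a central commutator, which a second p-th power kills. For p
    = 2 the p-th power map itself need not be multiplicative, whence the exponent p^2. *)
Lemma mul_exp_p2 x y : x \in N -> y \in N ->
  ((x * y) ^+ (p * p) = x ^+ (p * p) * y ^+ (p * p))%g.
Proof.
move=> Nx Ny; have [s ys _] := comN Ny Nx.
have Nc : [~ y, x]%g \in N by rewrite groupR.
have /centerP[_ cc] := scalar_central fN Nc ys.
have cen z : z \in N -> forall u, u \in N -> commute (z ^+ p)%g u.
  move=> Nz u Nu; have [r zr] := powN Nz.
  by have /centerP[_ cz] := scalar_central fN (groupX p Nz) zr; apply: cz.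
rewrite !expgM expMg_Rmul; try by apply: commute_sym; apply: cc.
have Nxp := groupX p Nx; have Nyp := groupX p Ny.
rewrite expgMn; last first.
  by apply: commuteX; apply: commute_sym; apply: commuteM; apply: cc.
rewrite expgMn; last by apply: cen.
by rewrite -(expgM [~ y, x]%g) mulnC expgM comm_exp_p // expg1n mulg1.
Qed.

Variables (n : nat) (z : F).
Hypotheses (nE : n = (p * #|N|)%N) (prz : n.-primitive_root z).

Let n_gt1 : (1 < n)%N.
Proof. by rewrite nE (leq_trans (prime_gt1 p_pr)) // leq_pmulr. Qed.

Let rho (u : gT * 'Z_n) : 'M[F]_d := z ^+ u.2 *: rN u.1.

(** The multiples z^k x whose order divides p^2, kept as pairs. [mul_exp_p2] makes this a group, and
    the exponent p^2 makes the scalar (z^k x)^p a p-th root of unity. *)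
Let Q0 : {set gT * 'Z_n} :=
  [set u : gT * 'Z_n | (u.1 \in N) && ((z ^+ u.2) ^+ (p * p) *: rN (u.1 ^+ (p * p))%g == 1%:M)]%SET.

Let zM (k l : 'Z_n) : z ^+ (k * l)%g = z ^+ k * z ^+ l.
Proof.
have modz m : z ^+ (m %% (Zp_trunc n).+2) = z ^+ m.
  by rewrite Zp_cast // (prim_expr_mod prz).
by rewrite /mulg /= modz exprD.
Qed.

Let Q0_group : group_set Q0.
Proof.
apply/group_setP; split.
  rewrite inE /= group1 expg1n repr_mx1 /=.
  have -> : z ^+ (1%g : 'Z_n) = 1 by rewrite /oneg /= expr0.
  by rewrite expr1n scale1r.
move=> u v; rewrite !inE => /andP[Nu /eqP pu] /andP[Nv /eqP pv].
rewrite groupM //= zM exprMn mul_exp_p2 // repr_mxM ?groupX //.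
by rewrite -scalerA scalemxAr scalemxAl pv pu mulmx1.
Qed.

Let Q0G := group Q0_group.

Let rho_repr : mx_repr Q0G rho.
Proof.
split; first by rewrite /rho repr_mx1 /oneg /= expr0 scale1r.
move=> u v; rewrite !inE => /andP[Nu _] /andP[Nv _].
by rewrite /rho /= zM repr_mxM // -scalemxAl -scalemxAr scalerA.
Qed.

Let rR := MxRepresentation rho_repr.

(** Pairs with the same matrix are identified by passing to the quotient by the kernel. The last
    clause shows that the image is stable under every linear group that normalises the image of
    N. *)
Lemma scalar_extension : exists (qT : finGroupType) (Q : {group qT})
    (rQ : mx_representation F Q d),
  [/\ [/\ mx_faithful rQ, ~~ abelian Q & scalar_commutant rQ Q],
      forall x, x \in Q -> exists2 s, rQ (x ^+ p)%g = s%:M & s ^+ p = 1,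
      forall x y, x \in Q -> y \in Q ->
        exists2 s, rQ [~ x, y]%g = s%:M & s ^+ p = 1
    & forall h, repr_image rQ h <-> exists k x,
        [/\ x \in N, h = z ^+ k *: rN x
          & (z ^+ k) ^+ (p * p) *: rN (x ^+ (p * p))%g = 1%:M]].
Proof.
have lift (k : nat) : exists k' : 'Z_n, z ^+ k' = z ^+ k.
  by exists (inZp k); rewrite /= Zp_cast // (prim_expr_mod prz).
have z0 k : z ^+ k != 0.
  rewrite expf_neq0 //; apply/eqP => z00; have := prim_expr_order prz.
  have n0 : (n == 0)%N = false by apply: gtn_eqF; apply: ltnW n_gt1.
  by rewrite z00 expr0n n0 => /eqP; rewrite eq_sym oner_eq0.
set rQ := kquo_repr rR.
have rQE v : v \in (Q0G / rker rR)%g -> exists k x,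
    [/\ x \in N, rQ v = z ^+ k *: rN x
      & (z ^+ k) ^+ (p * p) *: rN (x ^+ (p * p))%g = 1%:M].
  case/morphimP => u _ Q0u ->; rewrite /rQ kquo_repr_coset //.
  by move: Q0u; rewrite inE => /andP[Nu /eqP E]; exists u.2, u.1.
have rQP k x : x \in N -> (z ^+ k) ^+ (p * p) *: rN (x ^+ (p * p))%g = 1%:M ->
    exists2 v, v \in (Q0G / rker rR)%g & rQ v = z ^+ k *: rN x.
  move=> Nx E; have [k' zk] := lift k.
  have Qu : (x, k') \in Q0G by rewrite inE /= Nx zk E eqxx.
  exists (coset (rker rR) (x, k')); last by rewrite /rQ kquo_repr_coset // /rR /= /rho /= zk.
  exact: mem_quotient.
have powE v c x m : v \in (Q0G / rker rR)%g -> x \in N -> rQ v = c *: rN x ->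
    rQ (v ^+ m)%g = c ^+ m *: rN (x ^+ m)%g.
  move=> Qv Nx E; elim: m => [|m IH]; first by rewrite !expg0 !repr_mx1 expr0 scale1r.
  by rewrite !expgS !repr_mxM ?groupX // IH E -scalemxAl -scalemxAr scalerA exprS.
have exk x : x \in N -> exists2 v, v \in (Q0G / rker rR)%g &
    exists2 c, c != 0 & rQ v = c *: rN x.
  move=> Nx; have [s xs] := powN Nx.
  have sN : s ^+ #|N| = 1.
    have := scalar_exp #|N| (groupX p Nx) xs.
    rewrite expg_cardG ?groupX // repr_mx1 => /matrixP/(_ (Ordinal d_gt0) (Ordinal d_gt0)).
    by rewrite !mxE eqxx !mulr1n.
  (* Then (c x)^p = 1. Since s^|N| = 1, c is a root of unity of order dividing p |N|, which explains
     the choice of n. *)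
  pose c := p.-root (s^-1); have cp : c ^+ p = s^-1 by rewrite rootCK ?prime_gt0.
  have [|k ck] := prim_rootP prz (x := c).
    by rewrite nE exprM cp exprVn sN invr1.
  have s0 : s != 0.
    apply/eqP => s0; have := sN; rewrite s0 expr0n -leqn0 leqNgt cardG_gt0 /=.
    by move/eqP; rewrite eq_sym oner_eq0.
  have [|v Qv vE] := rQP k x Nx.
    rewrite -ck exprM cp expgM (scalar_exp p (groupX p Nx) xs) scale_scalar_mx.
    by rewrite -exprMn mulVf // expr1n.
  by exists v => //; exists (z ^+ k).
have scQ : scalar_commutant rQ (Q0G / rker rR)%G.
  move=> A cA; apply: scN => x Nx; have [v Qv [c c0 vE]] := exk x Nx.
  by have := cA v Qv; rewrite vE -scalemxAl -scalemxAr => /(scalerI c0).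
have fQ : mx_faithful rQ by apply: kquo_mx_faithful.
have nabQ : ~~ abelian (Q0G / rker rR)%g.
  apply: contra nabN => /centsP abQ; apply/centsP => x Nx y Ny.
  have [v Qv [c c0 vE]] := exk x Nx; have [w Qw [c' c0' wE]] := exk y Ny.
  apply: (faithful_inj fN); rewrite ?groupM // !repr_mxM //.
  have := congr1 (fun u => rQ u) (abQ v Qv w Qw); rewrite !repr_mxM // vE wE.
  rewrite -!scalemxAl -!scalemxAr !scalerA [c' * c]mulrC.
  by move/(scalerI (mulf_neq0 c0 c0')).
exists _, (Q0G / rker rR)%G, rQ; split=> //.
- move=> v Qv; have [k [x [Nx vE E]]] := rQE v Qv; have [s xs] := powN Nx.
  exists ((z ^+ k) ^+ p * s); first by rewrite (powE _ _ _ _ Qv Nx vE) xs scale_scalar_mx.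
  move: E; rewrite expgM (scalar_exp p (groupX p Nx) xs) exprM scale_scalar_mx.
  rewrite -exprMn => /matrixP/(_ (Ordinal d_gt0) (Ordinal d_gt0)).
  by rewrite !mxE eqxx !mulr1n.
- move=> v w Qv Qw; have [k [x [Nx vE _]]] := rQE v Qv.
  have [l [y [Ny wE _]]] := rQE w Qw; have [s xs sp] := comN Nx Ny.
  exists s => //; have Qwv : (w * v)%g \in (Q0G / rker rR)%g by rewrite groupM.
  have E : rQ (w * v)%g *m rQ [~ v, w]%g = rQ (w * v)%g *m s%:M.
    rewrite -repr_mxM ?groupR // -commgC !repr_mxM // vE wE.
    have XY : rN x *m rN y = s *: (rN y *m rN x).
      have Nc : [~ x, y]%g \in N by rewrite groupR.
      have -> : rN x *m rN y = rN (y * x * [~ x, y])%g by rewrite -commgC repr_mxM.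
      by rewrite (repr_mxM rN (groupM Ny Nx) Nc) xs mul_mx_scalar (repr_mxM rN Ny Nx).
    rewrite mul_mx_scalar; do 3!rewrite -?scalemxAl -?scalemxAr.
    by rewrite XY !scalerA; congr (_ *: _); move: (z ^+ k) (z ^+ l) => a b; ring.
  by rewrite -[LHS]mul1mx -(repr_mxVl rQ Qwv) -mulmxA E mulmxA repr_mxVl // mul1mx.
move=> h; split; first by case=> v /rQE[k [x [Nx -> E]]] ->; exists k, x.
by case=> k [x [Nx -> E]]; have [v Qv <-] := rQP k x Nx E; exists v.
Qed.

End ScalarExtension.

(** * Minimal normal subgroups of G / Z(G) *)

Section Structure.

Variables (F : numClosedFieldType) (d : nat) (gT : finGroupType) (G : {group gT}).
Variable rG : mx_representation F G d.
Variables (e : F) (B C : 'M[F]_d) (GG : set 'M[F]_d).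
Hypotheses (d_gt4 : (4 < d)%N) (fp : form_pair e B C).
Hypotheses (std : std_endT2 (repr_image rG) B C) (fG : mx_faithful rG).
Hypothesis sub : repr_image rG `<=` GG.
Hypothesis GGP : GG = @GLV F d \/
  ((forall g, repr_image rG g -> g *m B *m g^T = B) /\
   forall g, g *m B *m g^T = B -> GG g).

Local Notation Z := 'Z(G)%g.

Let d_gt0 : (0 < d)%N. Proof. exact: leq_ltn_trans d_gt4. Qed.

Lemma group_scalar_commutant : scalar_commutant rG G.
Proof.
move=> A cA; apply: (commutant_scalar d_gt4 fp std) => _ [x Gx ->].
exact: cA.
Qed.

(** An abelian L lies in its own commutant, so it would consist of scalars and commute even with a
    nonscalar matrix unit. *)
Lemma scalar_group_abelian (L : {group gT}) : L \subset G ->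
  scalar_commutant rG L -> ~~ abelian L.
Proof.
move=> sLG scL; apply/negP => /centsP abL.
have sc x : x \in L -> exists a, rG x = a%:M.
  move=> Lx; apply: scL => y Ly; rewrite -!repr_mxM ?(fintype.subsetP sLG) //.
  by rewrite abL.
pose i0 := Ordinal d_gt0; pose i1 : 'I_d := Ordinal (ltn_trans (isT : 1 < 4)%N d_gt4).
have [x Lx|a /matrixP/(_ i0 i1)] := scL (delta_mx i0 i1).
  by have [a ->] := sc x Lx; rewrite scalar_mxC.
by rewrite !mxE !eqxx /= mulr0n => /eqP; rewrite oner_eq0.
Qed.

Lemma normal_noncentral (L : {group gT}) : (L <| G)%g -> ~~ (L \subset Z) ->
  scalar_commutant rG L.
Proof.
move=> nLG nLZ; apply: (normal_scalar_commutant d_gt4 fp std nLG).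
have [x Lx nZx] := fintype.subsetPn nLZ; exists x => // a xa.
case/negP: nZx; apply: (scalar_central fG _ xa).
exact: fintype.subsetP (normal_sub nLG) x Lx.
Qed.

(** S is minimal normal in M, and distinct conjugates of S commute. Once [Ls_le1] makes the derived
    preimage L of S normal in G, minimality of M gives S = M; being minimal normal in itself, M is
    simple. *)
Lemma nonabelian_minnormal_quotient (M : {group coset_of Z}) :
    minnormal M (G / Z)%g -> M \subset (G / Z)%g -> ~~ abelian M ->
  almost_simple (G / Z)%G.
Proof.
move=> minM sMG nabM; have nZG : (G \subset 'N(Z))%g := normal_norm (center_normal G).
have /mingroupP[/andP[ntM nMG] minMP] := minM.
have cosG : (coset Z @*^-1 (G / Z) = G)%g by rewrite quotientGK ?center_normal.
have preG (T : {group coset_of Z}) : T \subset (G / Z)%g -> (coset Z @*^-1 T \subset G)%g.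
  move=> sTG; suff: (coset Z @*^-1 T \subset coset Z @*^-1 (G / Z))%g by rewrite cosG.
  exact: morphpreS.
have [S minS sSM] := minnormal_exists ntM (normG M).
have /mingroupP[/andP[ntS nSM] minSP] := minS.
have sSG := fintype.subset_trans sSM sMG.
pose D := (coset Z @*^-1 S)%G; pose L := (D^`(1))%G.
have sDG : D \subset G by exact: preG.
have sLD : L \subset D by exact: der_sub.
have sLG := fintype.subset_trans sLD sDG.
have nZD := fintype.subset_trans sDG nZG.
have DZ : (D / Z = S)%g by rewrite cosetpreK.
have conjS x : x \in (G / Z)%g -> (S :^ x != S)%g -> (S :^ x \subset 'C(S))%g.
  move=> Gx nS; have Mx : (M :^ x = M)%g := normsP nMG x Gx.
  have nSxM : (M \subset 'N(S :^ x))%g by rewrite normJ -{1}Mx conjSg.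
  have sSxM : (S :^ x \subset M)%g by rewrite -Mx conjSg.
  have tiS : (S :&: S :^ x = 1)%g.
    apply: contrapT => /eqP nt.
    have SE : (S :&: S :^ x)%g = S.
      have := minSP (S :&: S :^ x)%G; rewrite /= nt finset.subsetIl.
      by rewrite normsI ?(fintype.subset_trans sSM) // => /(_ isT isT).
    case/eqP: nS; apply/eqP; rewrite eq_sym eqEcard cardJg leqnn andbT.
    by rewrite -{1}SE finset.subsetIr.
  rewrite (sameP commG1P trivgP) -tiS finset.subsetI.
  rewrite commg_subr (fintype.subset_trans sSxM nSM) /=.
  by rewrite commg_subl (fintype.subset_trans sSM nSxM).
have nabS : ~~ abelian S.
  apply: contra nabM => abS.
  (* M is generated by the conjugates of S, which commute with each other; an abelian S would make M
     abelian. *)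
  have K_M : (<<class_support S (G / Z)>> = M)%g.
    apply: minMP; last first.
      rewrite gen_subG class_supportEr; apply/finset.bigcupsP => x Gx.
      by rewrite -(normsP nMG x Gx) conjSg.
    rewrite /= norms_gen ?class_support_norm // andbT.
    apply: contra ntS => /eqP K1; rewrite -subG1 -K1 sub_gen //.
    exact: sub_class_support.
  rewrite -K_M /= abelian_gen /abelian; apply/centsP.
  move=> u; rewrite class_supportEr => /finset.bigcupP[x Gx Su].
  move=> v /finset.bigcupP[y Gy Sv].
  have [u' Su' uE] := imsetP Su; have [v' Sv' vE] := imsetP Sv.
  have Gyx : (y * x^-1)%g \in (G / Z)%g by rewrite groupM ?groupV.
  have com w w' : w \in S -> w' \in (S :^ (y * x^-1))%g -> commute w w'.
    move=> Sw Sw'; have [SE|nS] := eqVneq (S :^ (y * x^-1))%g S.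
      by rewrite SE in Sw'; apply: (centsP abS).
    by apply: commute_sym; apply: (centsP (conjS _ Gyx nS)).
  rewrite uE vE /commute.
  have -> : (v' ^ y = (v' ^ (y * x^-1)) ^ x)%g by rewrite -conjgM mulgKV.
  by rewrite -!conjMg (com u') ?memJ_conjg.
have perfS : (S^`(1) = S)%g.
  apply: minSP; rewrite ?der_sub //= (char_norm_trans (der_char 1 S) nSM) andbT.
  by apply: contra nabS => /eqP/derG1P.
have LZ : (L / Z = S)%g by rewrite /= quotient_der // DZ perfS.
have nabL : ~~ abelian L.
  by apply: contra nabS => abL; rewrite -LZ quotient_abelian.
(* Three subgroups: a group that centralizes D modulo Z centralizes D'. *)
have cent_der (T : {group gT}) : T \subset G -> ([~: T, D] \subset Z)%g -> (T \subset 'C(L))%g.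
  move=> sTG cTD; have TDD : ([~: T, D, D] = 1)%g.
    apply/commG1P; apply: fintype.subset_trans cTD _.
    by rewrite (fintype.subset_trans (finset.subsetIr _ _)) // centS.
  have DTD : ([~: D, T, D] = 1)%g by rewrite [[~: D, T]%g]commGC.
  have DDT := three_subgroup DTD TDD.
  by rewrite centsC; apply/commG1P.
pose Ls : {set {group gT}} := ((fun g => (L :^ g)%G) @: G)%SET.
have LsP T : T \in Ls -> exists2 g, g \in G & T = (L :^ g)%G by case/imsetP => g; exists g.
have L_com g : g \in G -> (L :^ g)%g != L -> (L :^ g \subset 'C(L))%g.
  move=> Gg nL; have Ng := fintype.subsetP nZG g Gg.
  have Dg : (D :^ g = coset Z @*^-1 (S :^ coset Z g))%g by rewrite /= morphpreJ.
  have Gcg : coset Z g \in (G / Z)%g by apply: mem_quotient.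
  have nS : (S :^ coset Z g)%g != S.
    apply: contra nL => /eqP SE; rewrite -derJ Dg SE; exact: eqxx.
  have sDgG : (D :^ g \subset G)%g by rewrite -(conjGid Gg) conjSg.
  apply: fintype.subset_trans (cent_der (D :^ g)%G sDgG _).
    by rewrite conjSg.
  rewrite -quotient_cents2 ?(fintype.subset_trans sDgG) //=.
  by rewrite Dg !cosetpreK; apply: conjS.
have le1 : (#|Ls| <= 1)%N.
  apply: (@Ls_le1 F d gT G rG e B C d_gt4 fp std fG Ls #|L|).
  - by move=> _ /LsP[g Gg ->]; have := sLG; rewrite -(conjSg _ _ g) (conjGid Gg).
  - move=> _ h Gh /LsP[g Gg ->]; apply/imsetP; exists (g * h)%g; rewrite ?groupM //.
    by apply: val_inj; rewrite /= conjsgM.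
  - move=> _ _ /LsP[g Gg ->] /LsP[h Gh ->] nL.
    have -> : ((L :^ h)%G :=: (L :^ (h * g^-1)) :^ g)%g by rewrite -conjsgM mulgKV.
    rewrite /= centJ conjSg; apply: L_com; first by rewrite groupM ?groupV.
    apply: contra nL => /eqP E; apply/eqP/val_inj => /=.
    by rewrite -{1}E -conjsgM mulgKV.
  - by move=> _ /LsP[g Gg ->]; rewrite /= abelianJ.
  - by move=> _ /LsP[g Gg ->]; rewrite /= cardJg.
have nLG : (L <| G)%g.
  rewrite /normal sLG; apply/normsP => g Gg.
  have L1 : L \in Ls by apply/imsetP; exists 1%g => //; apply: val_inj; rewrite /= conjsg1.
  have Lg : (L :^ g)%G \in Ls by apply/imsetP; exists g.
  by have /card_le1_eqP/(_ _ _ Lg L1)/(congr1 (@gval _)) := le1.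
have SM : S :=: M.
  apply: minMP => //; rewrite ntS -LZ; exact: quotient_norms (normal_norm nLG).
(* An element of G whose image centralises M commutes with L by [cent_der], hence is scalar because
   L is irreducible. *)
have cM1 : ('C_(G / Z)(M) = 1)%g.
  pose T := (coset Z @*^-1 ('C_(G / Z)(M)))%G.
  have sTG : T \subset G by apply: preG; apply: finset.subsetIl.
  have cTD : ([~: T, D] \subset Z)%g.
    rewrite -quotient_cents2 ?(fintype.subset_trans sTG) //= !cosetpreK SM.
    exact: finset.subsetIr.
  have scL : scalar_commutant rG L.
    apply: normal_noncentral nLG _; apply: contra nabL => sLZ.
    by rewrite (abelianS sLZ) ?center_abelian.
  have sTZ : T \subset Z.
    apply/fintype.subsetP => t Tt; have Gt := fintype.subsetP sTG t Tt.
    have [|a ta] := scL (rG t); last exact: (scalar_central fG Gt ta).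
    move=> x Lx; have Gx := fintype.subsetP sLG x Lx; rewrite -!repr_mxM //.
    by congr (rG _); apply: esym; apply: (centsP (cent_der T sTG cTD)).
  by rewrite -(cosetpreK 'C_(G / Z)(M))%g -[(_ @*^-1 _)%g]/(gval T) quotientS1.
exists (coset_of Z), M, (conj_aut M @* (G / Z))%G; split=> //.
- by move: minS; rewrite SM.
- exact: morphimS.
- exact: Aut_conj_aut.
have := first_isog_loc (conj_aut M) nMG.
rewrite ker_conj_aut cM1 => H; exact: isog_trans (quotient1_isog _) H.
Qed.

Lemma normalizes_image (H : set 'M[F]_d) :
    (forall y h, y \in G -> H h -> H (rG y^-1%g *m h *m rG y)) ->
  repr_image rG `<=` lin_normalizer GG H.
Proof.
move=> nH g gG; split; first exact: sub.
case: gG => y Gy ->; rewrite -repr_mxV //; apply/seteqP; split=> h.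
  by case=> k Hk <-; apply: nH.
move=> Hh; exists (rG y *m h *m rG y^-1%g).
  by have := nH y^-1%g h; rewrite invgK groupV; apply.
by rewrite !mulmxA repr_mxVl // mul1mx -mulmxA repr_mxVl // mulmx1.
Qed.

(** For GL(V), H is the image of the scalar extension of N. For an isometry group H must stay inside
    [GG], and N itself serves, because its central elements act as 1 or -1. *)
Lemma abelem_minnormal_quotient (M : {group coset_of Z}) p :
    (M <| G / Z)%g -> M :!=: 1%g -> prime p -> (p.-abelem M)%g ->
  exists (p a : nat) (H : set 'M[F]_d),
    [/\ prime p, d = (p ^ a)%N,
        [/\ is_linear_group H, H `<=` GG, irreducible_on H & symplectic_type p H]
      & repr_image rG `<=` lin_normalizer GG H].
Proof.
move=> nMG ntM p_pr abM; have nZG : (G \subset 'N(Z))%g := normal_norm (center_normal G).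
pose N := (coset Z @*^-1 M)%G.
have nNG : (N <| G)%g.
  by rewrite -[X in (_ <| X)%g](quotientGK (center_normal G)) cosetpre_normal.
have sNG := normal_sub nNG; have nZN := fintype.subset_trans sNG nZG.
have NZ : (N / Z = M)%g by rewrite cosetpreK.
have scN : scalar_commutant rG N.
  apply: normal_noncentral nNG _; apply: contra ntM => sNZ.
  by rewrite -NZ quotientS1.
have nabN := scalar_group_abelian sNG scN.
have scG := group_scalar_commutant.
have powZ x : x \in N -> (x ^+ p \in Z)%g.
  move=> Nx; have nx := fintype.subsetP nZN x Nx.
  apply: coset_idr; rewrite ?groupX // morphX //.
  have Mx : coset Z x \in M by rewrite -NZ mem_quotient.
  by have [_ ->] := abelemP p_pr abM.
have comZ x y : x \in N -> y \in N -> ([~ x, y] \in Z)%g.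
  move=> Nx Ny; apply: fintype.subsetP (_ : N^`(1) \subset Z)%g _ _.
    by apply: der1_min; rewrite // NZ (abelem_abelian abM).
  exact: mem_commg.
pose rN := subg_repr rG sNG.
have fN : mx_faithful rN := subg_mx_faithful sNG fG.
have powN x : x \in N -> exists s, rN (x ^+ p)%g = s%:M.
  by move=> Nx; apply: (central_scalar scG (powZ x Nx)).
have comN x y : x \in N -> y \in N -> exists2 s, rN [~ x, y]%g = s%:M & s ^+ p = 1.
  move=> Nx Ny; have [s xs] := central_scalar scG (comZ x y Nx Ny); exists s => //.
  have Gx := fintype.subsetP sNG x Nx; have Gy := fintype.subsetP sNG y Ny.
  have cx : commute x [~ x, y]%g by apply: commute_sym; have /centerP[_] := comZ x y Nx Ny; apply.
  (* This power is the commutator of x^p and y, and x^p is central. *)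
  have : ([~ x, y] ^+ p = 1)%g.
    rewrite -commXg //; apply/eqP/commgP; have /centerP[_] := powZ x Nx; exact.
  move/(congr1 (fun u => rG u)); rewrite (scalar_exp p _ xs) ?groupR // repr_mx1.
  by move=> /matrixP/(_ (Ordinal d_gt0) (Ordinal d_gt0)); rewrite !mxE eqxx !mulr1n.
case: GGP => [GGE|[iso isoGG]].
  have n0 : (0 < p * #|N|)%N by rewrite muln_gt0 prime_gt0 ?cardG_gt0.
  have [z prz] := prim_root_exists F n0.
  have [qT [Q [rQ [[fQ nabQ scQ] powQ comQ imQ]]]] :=
    @scalar_extension F d gT N rN p d_gt0 p_pr fN nabN scN powN comN _ z (erefl _) prz.
  have [_ _ [a da]] := symplectic_type_factor d_gt0 p_pr fQ nabQ scQ powQ comQ.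
  exists p, a, (repr_image rQ); split=> //.
    split; [exact: repr_image_linear_group| |exact: repr_image_irreducible|].
      by rewrite GGE => _ [x Qx ->]; apply: repr_mx_unit.
    exact: repr_image_symplectic.
  apply: normalizes_image => y h Gy /imQ[k [x [Nx -> E]]]; apply/imQ.
  have Gx := fintype.subsetP sNG x Nx.
  have conjE u : u \in N -> rN (u ^ y)%g = rG y^-1%g *m rN u *m rG y.
    move=> Nu; have Gu := fintype.subsetP sNG u Nu.
    by rewrite /= conjgE !repr_mxM ?groupM ?groupV // mulmxA.
  have Nxy : (x ^ y)%g \in N by rewrite memJ_norm // (fintype.subsetP (normal_norm nNG)).
  exists k, (x ^ y)%g; split=> //; first by rewrite conjE // -scalemxAr -scalemxAl.
  rewrite -conjXg conjE ?groupX // -mulmxA scalemxAr scalemxAl.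
  by rewrite E mul1mx repr_mxVl.
have sqr1 x s : x \in G -> rG x = s%:M -> s ^+ 2 = 1.
  move=> Gx xs; have /iso : repr_image rG (rG x) by exists x.
  rewrite xs tr_scalar_mx mul_scalar_mx mul_mx_scalar scalerA => sB.
  have : (s * s - 1) *: B = 0 by rewrite scalerBl scale1r sB subrr.
  move/eqP; rewrite scaler_eq0 => /orP[|/eqP B0]; last by case: (form_neq0 d_gt4 fp).
  by rewrite subr_eq0 expr2 => /eqP.
have [x [y [Nx Ny nxy]]] : exists x y, [/\ x \in N, y \in N & [~ x, y]%g != 1%g].
  apply: contrapT => no; case/negP: nabN; apply/centsP => x Nx y Ny.
  by apply/commgP; apply: contrapT => /negP nxy; apply: no; exists x, y.
(* A nontrivial commutator acts as -1, and its p-th power is 1. *)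
have p2 : p = 2%N.
  have [s xs sp] := comN x y Nx Ny.
  have Gc : [~ x, y]%g \in G by rewrite groupR ?(fintype.subsetP sNG).
  have : s ^+ 2 = 1 by apply: sqr1 Gc xs.
  move/eqP; rewrite sqrf_eq1 => /orP[] /eqP sE.
    case/eqP: nxy; apply: (faithful_inj fG) => //.
    by rewrite repr_mx1 -sE -xs.
  have [//|odd_p] := even_prime p_pr.
  move: sp; rewrite sE -signr_odd odd_p expr1 => /eqP.
  by rewrite eq_sym -addr_eq0 -(natrD _ 1 1) pnatr_eq0.
have powN2 u : u \in N -> exists2 s, rN (u ^+ p)%g = s%:M & s ^+ p = 1.
  move=> Nu; have [s us] := powN u Nu; exists s => //; rewrite p2.
  by apply: sqr1 us; rewrite groupX ?(fintype.subsetP sNG).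
have [_ _ [a da]] := symplectic_type_factor d_gt0 p_pr fN nabN scN powN2 comN.
exists p, a, (repr_image rN); split=> //.
  split; [exact: repr_image_linear_group| |exact: repr_image_irreducible|].
    move=> _ [u Nu ->]; apply: sub; exists u => //; exact: fintype.subsetP sNG u Nu.
  exact: repr_image_symplectic.
apply: normalizes_image => w _ Gw [u Nu ->]; exists (u ^ w)%g.
  by rewrite memJ_norm // (fintype.subsetP (normal_norm nNG)).
have Gu := fintype.subsetP sNG u Nu.
by rewrite /= conjgE !repr_mxM ?groupM ?groupV // mulmxA.
Qed.

Lemma almost_simple_or_symplectic :
  almost_simple (G / Z)%G \/
  exists (p a : nat) (H : set 'M[F]_d),
    [/\ prime p, d = (p ^ a)%N,
        [/\ is_linear_group H, H `<=` GG, irreducible_on H & symplectic_type p H]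
      & repr_image rG `<=` lin_normalizer GG H].
Proof.
have nabG := scalar_group_abelian (subxx_hint (mem G)) group_scalar_commutant.
have ntGZ : (G / Z)%g != 1%g.
  apply: contra nabG => /eqP GZ1; rewrite (abelianS _ (center_abelian G)) //.
  by rewrite -quotient_sub1 ?GZ1 ?subxx_hint // normal_norm ?center_normal.
have [M minM sMG] := minnormal_exists ntGZ (normG (G / Z)%G).
have /mingroupP[/andP[ntM nMG] _] := minM.
have [abM|nabM] := boolP (abelian M); last first.
  by left; apply: nonabelian_minnormal_quotient minM sMG nabM.
right; have abeM := charsimple_solvable (minnormal_charsimple minM) (abelian_sol abM).
have [p p_pr pM] := is_abelemP abeM.
by apply: abelem_minnormal_quotient p_pr pM => //; apply/andP.
Qed.

End Structure.

Theorem proposition1p2 (R : realType) (d : nat) (GG : set 'M[R[i]]_d)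
    (gT : finGroupType) (G : {group gT}) (rG : mx_representation R[i] G d) :
  (4 < d)%N ->
  is_GL_O_or_Sp GG ->
  mx_faithful rG ->
  repr_image rG `<=` GG ->
  M4 (repr_image rG) = M4 GG ->
  [/\ ~ preserves_tensor_structure (repr_image rG),
      primitive_on (repr_image rG)
    & almost_simple (G / 'Z(G))%G \/
      exists (p a : nat) (H : set 'M[R[i]]_d),
        [/\ prime p, d = (p ^ a)%N,
            [/\ is_linear_group H, H `<=` GG, irreducible_on H
              & symplectic_type p H]
          & repr_image rG `<=` lin_normalizer GG H]].
Proof.
move=> d4 GGP fG sub eqM4.
have [e [B [C [fp std alt]]]] := M4_std_endT2 d4 GGP sub eqM4.
split; first exact: (std_endT2_no_tensor d4 fp std).
  split; last exact: (std_endT2_no_sum d4 fp std).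
  apply: repr_image_irreducible; first exact: leq_ltn_trans d4.
  exact: (group_scalar_commutant d4 fp std).
exact: (almost_simple_or_symplectic d4 fp std fG sub alt).
Qed.
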